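(* Let $G$ be a finite abelian group (written additively) of order $2^d m$, where $m$ is odd, and suppose that the Sylow-$2$-subgroup of $G$ is cyclic. Let $\mathcal{C}\subseteq G$ be an inverse-closed subset with $0\notin\mathcal{C}$ and let $X=X(G,\mathcal{C})$ be the corresponding Cayley graph. If $d=0$, there is no perfect state transfer on $X$. If $d=1$, there is perfect state transfer on $X$ if and only if $X$ is a (perfect) matching, i.e. $X\cong mK_2$. Suppose $d\ge 2$. Let $a$ be the unique element of order two in $G$, and let $b,-b$ be the unique pair of elements of order four in $G$. For $k\ge 0$ let $\mathcal{C}_k$ denote the set of elements of $\mathcal{C}$ whose order is of the form $2^k m'$ with $m'$ odd. Then $X$ has perfect state transfer if and only if all of the following hold: (a) $\mathcal{C}$ is power-closed; (b) either $a$ or $b$ is in $\mathcal{C}$, but not both; (c) $\mathcal{C}_0 = 4(\mathcal{C}_2\setminus\{-b,b\})$; (d) $\mathcal{C}_1\setminus\{a\} = 2(\mathcal{C}_2\setminus\{-b,b\})$.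
   Context: The Cayley graph $X(G,\mathcal{C})$ of a group $G$ with inverse-closed connection set $\mathcal{C}\subseteq G$ has vertex set $G$, with $g$ and $h$ adjacent iff $h-g\in\mathcal{C}$. For a graph $X$ with adjacency matrix $A$, the transition matrix at time $t\in\mathbb{R}$ is $U(t)=e^{itA}$. There is perfect state transfer on $X$ (at time $\tau$) if there are distinct vertices $u,v$ with $|U(\tau)_{u,v}|=1$; ''$X$ has perfect state transfer'' means this happens for some time $\tau$. Two elements $g,h\in G$ are power-equivalent if $\langle g\rangle=\langle h\rangle$; the equivalence classes are called power classes, and a subset of $G$ is power-closed if it is a union of power classes. For $k\in\mathbb{N}$ and $\mathcal{S}\subseteq G$, $k\mathcal{S}:=\{k\cdot g: g\in\mathcal{S}\}$. *)

(* Defs.v *)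
From HB Require Import structures.
From mathcomp Require Export all_boot all_order all_algebra all_fingroup.
From mathcomp Require Export all_solvable complex.
From mathcomp Require Export all_classical all_reals all_analysis.

Set Implicit Arguments.
Unset Strict Implicit.
Unset Printing Implicit Defensive.

Import Order.TTheory GRing.Theory Num.Theory.
Import numFieldNormedType.Exports.

Local Open Scope ring_scope.

(* Graphs are relations on a finite vertex type. *)

Definition graph_iso (S T : finType) (e : rel S) (f : rel T) : Prop :=
  exists2 h : S -> T, bijective h & forall x y, f (h x) (h y) = e x y.

(* m K_2: the two vertices of the i-th copy of K_2 are (i, false), (i, true). *)
Definition copies_K2 (m : nat) : rel ('I_m * bool) :=
  fun u v => (u.1 == v.1) && (u.2 != v.2).

Definition cayley_graph (G : finZmodType) (C : {set G}) : rel G :=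
  fun g h => h - g \in C.

Definition expmx (K : numFieldType) (n : nat) (M : 'M[K]_n) : 'M[K]_n :=
  limn (series (fun k : nat => (k`!%:R)^-1 *: M ^+ k)).

(* Rows and columns are indexed by the vertices through enum_val/enum_rank. *)
Definition adjacency (K : numFieldType) (T : finType) (e : rel T) :
    'M[K]_#|T| :=
  \matrix_(i, j) (e (enum_val i) (enum_val j))%:R.

Definition transition (R : realType) (T : finType) (e : rel T) (t : R) :
    'M[R[i]]_#|T| :=
  expmx (('i%C * t%:C%C) *: adjacency R[i] e).

Definition perfect_state_transfer (R : realType) (T : finType) (e : rel T) :
    Prop :=
  exists (t : R) (u v : T),
    u != v /\ `|transition e t (enum_rank u) (enum_rank v)| = 1.

(* A finZmodType carries its additive group as a finGroupType structure, so
   that below <[g]> and #[g] are the additive cyclic subgroup generated by g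
   and the additive order of g. *)

Definition power_class (G : finZmodType) (g : G) : {set G} :=
  [set h | <[g]>%g == <[h]>%g].

Definition power_closed (G : finZmodType) (S : {set G}) : Prop :=
  exists2 P : {set {set G}},
    P \subset [set power_class g | g in [set: G]] & S = finset.cover P.

Definition order_part (G : finZmodType) (C : {set G}) (k : nat) : {set G} :=
  [set g in C | `[< exists2 m' : nat, odd m' & #[g]%g = (2 ^ k * m')%N >]].

Definition mulset (G : finZmodType) (k : nat) (S : {set G}) : {set G} :=
  [set g *+ k | g in S].

(* Main.v *)
From mathcomp Require Import all_field all_character ring zify.
Require Import Defs.
Import Order.TTheory GRing.Theory Num.Theory.
Import numFieldNormedType.Exports.

Set Implicit Arguments.
Unset Strict Implicit.
Unset Printing Implicit Defensive.

Local Open Scope ring_scope.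

(** The eigenvalues of X are the sums F(f) of the characters f over C, and the
    entries of U(t) are |G|^-1 times the Fourier sums of exp(i t F(f)).  Since
    only equal unit numbers average to a unit number, perfect state transfer at
    time t means that f(a) exp(i t F(f)) = exp(i t F(0)) for all f and some
    a != 0; replacing f by its inverse gives 2a = 0, hence the case d = 0.

    Necessity: t (F(f) - F(0)) = pi q_f with q_f an integer, and since the trace
    of A vanishes, pi / t is rational.  Thus all F(f) are integers, Galois
    automorphisms show that C is power-closed, and F(f) = |C| + M e_f with the
    parity of e_f given by f(a).  Let w be a character that kills the elements
    of odd order, with w(a) = -1.  Partial Fourier inversion over the characters
    w^j psi, with psi trivial on the Sylow 2-subgroup P (an odd number of psi),
    gives congruences modulo 2M for the sums of w^j over (h + P) :&: C, h of odd
    order.  By power-closedness these sums are [h] - [h+a] for j = 1 and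
    [h] + [h+a] - [h+b] - [h-b] for j = 2.  The case h = 0 gives a in C or b in C
    but not both, and M even; the case h != 0 then shows that h, h + a and h + b
    are simultaneously in C, which is (c) and (d).

    Sufficiency: C minus {a, b, -b} is power-closed and stable under translation
    by b, so its character sums are integers divisible by 4, and t = pi / 2
    works. *)

(* The minimal polynomial of zA over the rationals is irreducible, so any of
   its roots satisfies the same rational relations as zA. *)
Lemma rational_conjugate (K : numClosedFieldType) (zA : algC) :
  exists z : K, forall p : {poly rat},
    root (map_poly ratr p) z = root (map_poly ratr p) zA.
Proof.
have [p0 [Ep0 mon_p0] dv_p0] := minCpolyP zA.
have p0_gt1 : (1 < size p0)%N.
  by have := size_minCpoly zA; rewrite Ep0 size_map_poly.
have [z rz] : exists z : K, root (map_poly ratr p0) z.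
  by apply/closed_rootP; rewrite size_map_poly neq_ltn p0_gt1 orbT.
exists z => p; rewrite dv_p0; apply/idP/idP => [rp | /dvdpP[q ->]]; last first.
  by rewrite rmorphM rootM rz orbT.
(* A common root [z] of [p0] and [p] is a root of their gcd. The minimal polynomial [p0] divides
   this gcd or its cofactor [h]; the latter would leave a nonzero constant gcd with a root. *)
have rg : root (map_poly ratr (gcdp p0 p) : {poly K}) z.
  by rewrite gcdp_map root_gcd rz.
have /dvdpP[h Eh] := dvdp_gcdl p0 p.
have : root (map_poly ratr p0) zA by rewrite dv_p0.
rewrite {1}Eh rmorphM rootM !dv_p0 => /orP[p0h|/dvdp_trans->//]; last first.
  exact: dvdp_gcdr.
have p0N0 : p0 != 0 by rewrite -size_poly_gt0 ltnW.
have hg0 : h * gcdp p0 p != 0 by rewrite -Eh.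
have [h0 g0] : h != 0 /\ gcdp p0 p != 0.
  by apply/andP; move: hg0; rewrite mulf_eq0 negb_or.
have sg : (size (gcdp p0 p) <= 1)%N.
  have := dvdp_leq h0 p0h; rewrite {1}Eh size_mul //; move: (gcdp p0 p) => g le.
  rewrite -(leq_add2l (size h)) addn1; apply: leq_trans (leqSpred _) _.
  by rewrite ltnS.
move: rg g0; rewrite (size1_polyC sg) map_polyC rootC /= fmorph_eq0 polyC_eq0.
by move=> ->.
Qed.

(** * Characters and Fourier inversion *)

(* Characters are encoded by their exponents with respect to a primitive
   [N]-th root of unity [z], so that the same finite dual group serves both
   [algC] and [R[i]]. *)
Definition dual (N : nat) (G : finZmodType) : {set {ffun G -> 'Z_N}} :=
  [set f : {ffun G -> 'Z_N} | [forall x, forall y, f (x + y) == f x + f y]].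

Definition character_value (F : fieldType) (z : F) (N : nat) (G : finZmodType)
  (f : {ffun G -> 'Z_N}) (x : G) : F := z ^+ f x.

Definition fourier (F : fieldType) (z : F) (N : nat) (G : finZmodType)
    (C : {set G}) (f : {ffun G -> 'Z_N}) : F :=
  \sum_(c in C) character_value z f c.

Section Dual.
Variables (N : nat) (G : finZmodType).
Implicit Types (f h : {ffun G -> 'Z_N}) (x y : G).
Local Notation D := (dual N G).

Lemma dualP f : reflect {morph f : x y / x + y} (f \in D).
Proof.
rewrite inE; apply: (iffP forallP) => [H x y | H x].
  by apply/eqP; move/forallP: (H x).
by apply/forallP => y; rewrite H.
Qed.

Lemma dual0 : 0 \in D.
Proof. by apply/dualP => x y; rewrite !ffunE addr0. Qed.

Lemma dualD f h : f \in D -> h \in D -> f + h \in D.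
Proof.
move=> /dualP fD /dualP hD; apply/dualP => x y.
by rewrite !ffunE fD hD addrACA.
Qed.

Lemma dualN f : f \in D -> - f \in D.
Proof. by move=> /dualP fD; apply/dualP => x y; rewrite !ffunE fD opprD. Qed.

Lemma dualMn f k : f \in D -> f *+ k \in D.
Proof.
move=> fD; elim: k => [|k IH]; first exact: dual0.
by rewrite mulrS dualD.
Qed.

Variables (F : fieldType) (z : F).
Hypotheses (N_gt1 : (1 < N)%N) (prim_z : N.-primitive_root z).
Local Notation ev := (character_value z).

(** The modulus of ['Z_N] is [N] only for [1 < N]; powers of [z] then do not see the reduction. *)
Lemma prim_exp_Zp_add (i j : 'Z_N) : z ^+ (i + j)%R = z ^+ i * z ^+ j.
Proof. rewrite -exprD -[RHS](prim_expr_mod prim_z); congr (z ^+ (_ %% _)).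
exact: Zp_cast. Qed.

Lemma prim_exp_Zp_inj (i j : 'Z_N) : z ^+ i = z ^+ j -> i = j.
Proof.
move/eqP; rewrite (eq_prim_root_expr prim_z) => /eqP.
have lt k : ((k : 'Z_N) < N)%N by rewrite -[X in (_ < X)%N](Zp_cast N_gt1).
by rewrite !modn_small // => /val_inj.
Qed.

Lemma ev0l x : ev (0 : {ffun G -> 'Z_N}) x = 1.
Proof. by rewrite /character_value ffunE expr0. Qed.

Lemma evDl f h x : ev (f + h) x = ev f x * ev h x.
Proof. by rewrite /character_value ffunE prim_exp_Zp_add. Qed.

Lemma evMnl f k x : ev (f *+ k) x = ev f x ^+ k.
Proof.
elim: k => [|k IH]; first by rewrite mulr0n ev0l.
by rewrite mulrS evDl IH exprS.
Qed.

Lemma evD f x y : f \in D -> ev f (x + y) = ev f x * ev f y.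
Proof. by move=> /dualP fD; rewrite /character_value fD prim_exp_Zp_add. Qed.

Lemma ev_neq0 f x : ev f x != 0.
Proof.
rewrite expf_neq0 //; apply/eqP => z0; have := prim_expr_order prim_z.
by rewrite z0 expr0n gtn_eqF ?(ltnW N_gt1) // => /eqP; rewrite eq_sym oner_eq0.
Qed.

Lemma ev0 f : f \in D -> ev f 0 = 1.
Proof.
move=> fD; apply: (mulfI (ev_neq0 f 0)).
by rewrite -evD // addr0 mulr1.
Qed.

Lemma evN f x : f \in D -> ev f (- x) = (ev f x)^-1.
Proof.
move=> fD; apply: (mulfI (ev_neq0 f x)).
by rewrite -evD // subrr ev0 // divff ?ev_neq0.
Qed.

Lemma evNl f x : ev (- f) x = (ev f x)^-1.
Proof.
apply: (mulfI (ev_neq0 f x)).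
by rewrite -evDl subrr ev0l divff ?ev_neq0.
Qed.

Lemma evMn f k x : f \in D -> ev f (x *+ k) = ev f x ^+ k.
Proof.
move=> fD; elim: k => [|k IH]; first by rewrite mulr0n ev0.
by rewrite mulrS evD // IH exprS.
Qed.

Lemma ev_eq1_dual f : (forall x, ev f x = 1) -> f = 0.
Proof.
move=> H; apply/ffunP => x; apply: prim_exp_Zp_inj.
by rewrite [LHS]H ffunE expr0.
Qed.

Lemma ev_expN f x : ev f x ^+ N = 1.
Proof. by rewrite exprAC (prim_expr_order prim_z) expr1n. Qed.

End Dual.

(** Reindexing by [s] multiplies the sum by [c], so [c - 1] times the sum is 0. The vanishing
    character sums below are instances. *)
Lemma sum_twisted_eq0 (F : fieldType) (V : finType) (B : {set V})
    (phi : V -> F) (s : V -> V) (c : F) : injective s ->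
  (forall x, (s x \in B) = (x \in B)) ->
  (forall x, x \in B -> phi (s x) = phi x * c) ->
  c != 1 -> \sum_(x in B) phi x = 0.
Proof.
move=> s_inj sB phiM c1; apply/eqP.
rewrite -(mulIr_eq0 _ (mulIf (_ : c - 1 != 0))) ?subr_eq0 //.
rewrite mulrBr mulr1 subr_eq0 big_distrl /= [X in _ == X](reindex_inj s_inj) /=.
by apply/eqP; rewrite [RHS](eq_bigl _ _ sB); apply: eq_bigr => x /phiM ->.
Qed.

(** * Orthogonality relations *)

Section Orthogonality.
Variables (N : nat) (G : finZmodType).
Hypotheses (N_gt1 : (1 < N)%N) (dvdGN : (#|G| %| N)%N).
Local Notation D := (dual N G).
Local Notation ev := (character_value _).

(** The irreducible characters of an abelian group are linear and their kernels meet trivially, so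
    one is nontrivial at [x]. Its values are [N]-th roots of unity and thus have exponents to the
    base [z]. *)
Lemma ev_separates_algC (z : algC) (x : G) : N.-primitive_root z ->
  x != 0 -> exists2 f, f \in D & character_value z f x != 1.
Proof.
move=> prim_z x0.
have abG : abelian [set: G] by apply/centsP => g _ h _; apply: addrC.
have [i /negP chi_x] : exists i, ~ x \in cfker 'chi[[set: G]%G]_i.
  apply/not_existsP => H; move/eqP: x0; apply; apply/set1gP.
  rewrite -(TI_cfker_irr [set: G]%G); apply/bigcapP => i _.
  by apply: contrapT; apply: H.
have lin_i : 'chi[[set: G]%G]_i \is a linear_char by apply/char_abelianP.
have chiN g : 'chi_i g ^+ N = 1.
  have /dvdnP[q ->] : (#[g]%g %| N)%N.
    by apply: dvdn_trans dvdGN; rewrite -cardsT order_dvdG ?inE.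
  by rewrite mulnC exprM lin_char_unity_root ?inE // expr1n.
pose e g := sval (prim_rootP prim_z (chiN g)).
pose f : {ffun G -> 'Z_N} := [ffun g => inZp (e g)].
have evf g : character_value z f g = 'chi_i g.
  rewrite /character_value ffunE /= [RHS](svalP (prim_rootP prim_z (chiN g))).
  rewrite -[RHS](prim_expr_mod prim_z); congr (z ^+ (_ %% _)).
  exact: Zp_cast.
exists f; last first.
  rewrite evf; apply: contra chi_x => chi1.
  by rewrite cfkerEirr inE (eqP chi1) lin_char1.
apply/dualP => g h; apply: (prim_exp_Zp_inj N_gt1 prim_z).
rewrite (prim_exp_Zp_add N_gt1 prim_z).
by rewrite -!/(character_value z f _) !evf -lin_charM ?inE.
Qed.

(** Separation is proved over [algC] but read off from the exponents, which makes it available over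
    every field with a primitive [N]-th root of unity. *)
Lemma dual_separates (x : G) : x != 0 -> exists2 f, f \in D & f x != 0.
Proof.
move=> x0; have [z prim_z] := C_prim_root_exists (ltnW N_gt1).
have [f fD evf] := ev_separates_algC prim_z x0; exists f => //.
by apply: contraNneq evf => f0; rewrite /character_value f0 expr0.
Qed.

Variables (F : fieldType) (z : F).
Hypothesis prim_z : N.-primitive_root z.

Lemma ev_eq1 (f : {ffun G -> 'Z_N}) x :
  (character_value z f x == 1) = (f x == 0).
Proof.
apply/eqP/eqP => [H | fx0]; last by rewrite /character_value fx0 expr0.
by apply: (prim_exp_Zp_inj N_gt1 prim_z); rewrite [LHS]H expr0.
Qed.

Lemma ev_separates x :
  (forall f, f \in D -> character_value z f x = 1) -> x = 0.
Proof.
move=> H; apply/eqP; apply: contraT => /dual_separates[f fD].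
by rewrite -ev_eq1 H // eqxx.
Qed.

Lemma sum_ev_group (f : {ffun G -> 'Z_N}) : f \in D ->
  \sum_x character_value z f x = (if f == 0 then #|G|%:R else 0).
Proof.
move=> fD; case: eqP => [-> | /eqP f0].
  rewrite (eq_bigr (fun=> 1)) ?sumr_const // => x _.
  by rewrite /character_value ffunE expr0.
have [y fy] : exists y, character_value z f y != 1.
  apply: contrapT => /forallNP H; case/eqP: f0; apply: (ev_eq1_dual N_gt1 prim_z).
  by move=> x; apply/eqP; apply: contraT => /H.
transitivity (\sum_(x in [set: G]) character_value z f x).
  by apply: eq_bigl => x; rewrite inE.
apply: (@sum_twisted_eq0 _ _ _ _ _ _ (addIr y) _ _ fy) => x.
  by rewrite !inE.
by rewrite (evD N_gt1 prim_z).
Qed.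

(** For nonzero [x], translation by a character separating [x] from 0 rescales the sum. *)
Lemma sum_ev_dual x :
  \sum_(f in D) character_value z f x = (if x == 0 then #|D|%:R else 0).
Proof.
case: eqP => [-> | /eqP x0].
  by rewrite (eq_bigr (fun=> 1)) ?sumr_const // => f /(ev0 N_gt1 prim_z).
have [h hD hx] := dual_separates x0.
apply: (@sum_twisted_eq0 _ _ _ (fun f => character_value z f x) _
  (character_value z h x) (addIr h)) => [f|f _|].
- apply/idP/idP => [fhD | fD]; last exact: dualD.
  by rewrite -(addrK h f) dualD ?dualN.
- exact: evDl.
- by rewrite ev_eq1.
Qed.

End Orthogonality.

(** The two orthogonality relations evaluate the sum of all character values, one as the order of
    the dual, the other as that of [G]. *)
Lemma card_dual (N : nat) (G : finZmodType) : (1 < N)%N -> (#|G| %| N)%N ->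
  #|dual N G| = #|G|.
Proof.
move=> N_gt1 dvdGN; have [z prim_z] := C_prim_root_exists (ltnW N_gt1).
apply/eqP; rewrite -(eqr_nat algC).
have : \sum_x \sum_(f in dual N G) character_value z f x =
    \sum_(f in dual N G) \sum_x character_value z f x by exact: exchange_big.
rewrite (eq_bigr _ (fun x _ => sum_ev_dual N_gt1 dvdGN prim_z x)) /=.
rewrite [RHS](eq_bigr _ (fun f fD => sum_ev_group N_gt1 prim_z fD)) /=.
rewrite -!big_mkcond (big_pred1 0) // => ->.
rewrite (bigD1 (0 : {ffun G -> 'Z_N})) ?dual0 //= eqxx big1 ?addr0 // => f /andP[_ /negPf->] //.
Qed.

Lemma exists_splitting_root (G : finZmodType) : exists (N : nat) (z : algC),
  [/\ (1 < N)%N, (#|G| %| N)%N & N.-primitive_root z].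
Proof.
have G0 : (0 < #|G|)%N by apply/card_gt0P; exists 0.
(* The factor 2 keeps [N] above 1 for the trivial group. *)
have N_gt1 : (1 < 2 * #|G|)%N by lia.
have [z prim_z] := C_prim_root_exists (ltnW N_gt1).
by exists (2 * #|G|)%N, z; rewrite dvdn_mull.
Qed.

(** Being a primitive root and having a given rational Fourier sum are rational polynomial
    conditions on the root. Rationality thus passes between [algC], with its Galois automorphisms
    and algebraic integers, and [R[i]], where the exponential lives. *)
Lemma conjugate_root_of_unity (K : numClosedFieldType) (N : nat) (zA : algC) :
  N.-primitive_root zA ->
  exists z : K, N.-primitive_root z /\
    forall (G : finZmodType) (C : {set G}) (f : {ffun G -> 'Z_N}) (q : rat),
      (fourier z C f == ratr q) = (fourier zA C f == ratr q).
Proof.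
move=> prim_zA.
have [z rootE] := rational_conjugate K zA; exists z; split.
  have unityE k : k.-unity_root z = k.-unity_root zA.
    by have := rootE ('X^k - 1); rewrite !rmorphB !rmorph1 /= !map_polyXn.
  move: prim_zA; rewrite /primitive_root_of_unity => /andP[-> /= /forallP H].
  by apply/forallP => i; rewrite unityE H.
move=> G C f q.
have := rootE (\sum_(c in C) 'X^(f c) - q%:P).
rewrite /root !rmorphB !rmorph_sum /= !hornerD !hornerN !horner_sum.
rewrite !map_polyC !hornerC !subr_eq0.
under eq_bigr do rewrite map_polyXn hornerXn.
by under [X in _ = (X == _) -> _]eq_bigr do rewrite map_polyXn hornerXn.
Qed.

(** * The exponential series *)

Section Convergence.
Local Open Scope classical_set_scope.

Lemma cvg_mx_entries (K : numFieldType) (m n : nat) (X : nat -> 'M[K]_(m, n))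
    (M : 'M[K]_(m, n)) :
  (forall i j, (fun k => X k i j) @ \oo --> M i j) -> X @ \oo --> M.
Proof.
move=> XM A [P nbhsP PA].
have near1 i : \forall k \near \oo, forall j, P i j (X k i j).
  by apply: filter_forall => j; apply: XM.
have near2 : \forall k \near \oo, forall i j, P i j (X k i j).
  exact: filter_forall.
by apply: filterS near2 => k Hk; apply: PA.
Qed.

Lemma limn_mx_entries (K : numFieldType) (m n : nat) (X : nat -> 'M[K]_(m, n))
    (M : 'M[K]_(m, n)) :
  (forall i j, (fun k => X k i j) @ \oo --> M i j) -> limn X = M.
Proof. by move=> /cvg_mx_entries; apply/cvg_lim/norm_hausdorff. Qed.

Variable R : realType.
(* [R[i]] carries its topology only as a generic [numFieldType]. *)
Local Notation K := (Num.NumField.sort (R[i] : numFieldType)).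
Implicit Types (u v : R^nat) (a b x : R).

Lemma cvg_real_complex u a :
  u @ \oo --> a -> (fun n => (u n)%:C%C : K) @ \oo --> (a%:C%C : K).
Proof.
move=> /cvgrPdist_lt ua; apply/cvgrPdist_lt => e e0.
(* A positive element of [R[i]] is real, so the complex epsilon amounts to a real one. *)
have [Ie Re0] : complex.Im e = 0 /\ 0 < complex.Re e.
  by move: e0; rewrite ltcE => /andP[/eqP].
have Ee : e = (complex.Re e)%:C%C by case: e Ie {e0 Re0} => r s /= ->.
near=> n; rewrite Ee -rmorphB normc_def /= expr0n addr0 sqrtr_sqr ltcR.
by near: n; apply: ua.
Unshelve. all: by end_near. Qed.

Lemma cvg_complex u v a b : u @ \oo --> a -> v @ \oo --> b ->
  (fun n => (u n +i* v n)%C : K) @ \oo --> ((a +i* b)%C : K).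
Proof.
move=> /cvg_real_complex ua /cvg_real_complex vb.
rewrite [X in _ --> X]complexE /=.
rewrite (_ : (fun n => _) = fun n => (u n)%:C%C + 'i%C * (v n)%:C%C).
  by apply: (cvgD ua); apply: (cvgM _ vb); apply: cvg_cst.
by apply/funext => n; rewrite [LHS]complexE.
Qed.

Definition expi x : R[i] := (cos x +i* sin x)%C.

Lemma expi_term x k :
  ('i%C * x%:C%C) ^+ k / k`!%:R = (cos_coeff x k +i* sin_coeff x k)%C :> R[i].
Proof.
have iE j : 'i%C ^+ j.*2 = ((-1) ^+ j)%:C%C :> R[i].
  by rewrite -muln2 mulnC exprM sqr_i rmorphXn rmorphN1.
have -> : k`!%:R^-1 = (k`!%:R^-1 : R)%:C%C :> R[i] by rewrite fmorphV rmorph_nat.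
rewrite exprMn -rmorphXn -mulrA -rmorphM /cos_coeff /sin_coeff /=.
case: (boolP (odd k)) => ok.
  have -> : 'i%C ^+ k = ((-1) ^+ k.-1./2)%:C%C * 'i%C :> R[i].
    by rewrite -iE -exprSr; congr (_ ^+ _); lia.
  by rewrite -mulrA mulrCA mulrC -rmorphM /= !mul0r mul1r; simpc; rewrite !mulrA.
have -> : 'i%C ^+ k = ((-1) ^+ k./2)%:C%C :> R[i].
  by rewrite -iE; congr (_ ^+ _); lia.
by rewrite -rmorphM /= !mul0r mul1r !mulrA.
Qed.

Lemma cvg_expi x :
  series (fun k => ('i%C * x%:C%C) ^+ k / k`!%:R : K) @ \oo --> (expi x : K).
Proof.
rewrite (_ : series _ = fun n =>
    (series (cos_coeff x) n +i* series (sin_coeff x) n)%C).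
  apply: cvg_complex; first by rewrite unlock; apply: is_cvg_series_cos_coeff.
  by rewrite unlock; apply: is_cvg_series_sin_coeff.
apply/funext => n; rewrite /series /=.
elim: n => [|n IH]; first by rewrite !big_nil.
by rewrite !big_nat_recr //= IH expi_term; simpc.
Qed.

Lemma expiD x y : expi (x + y) = expi x * expi y.
Proof. by rewrite /expi cosD sinD; simpc; rewrite [sin x * _ + _]addrC. Qed.

Lemma expi0 : expi 0 = 1.
Proof. by rewrite /expi cos0 sin0. Qed.

Lemma norm_expi x : `|expi x| = 1.
Proof. by rewrite normc_def /= cos2Dsin2 sqrtr1. Qed.

Lemma expi_neq0 x : expi x != 0.
Proof. by rewrite -normr_eq0 norm_expi oner_eq0. Qed.

Lemma expiN x : expi (- x) = (expi x)^-1.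
Proof.
apply: (mulfI (expi_neq0 x)).
by rewrite -expiD subrr expi0 divff ?expi_neq0.
Qed.

Lemma expi_mulrn x n : expi (x *+ n) = expi x ^+ n.
Proof.
elim: n => [|n IH]; first by rewrite mulr0n expi0.
by rewrite mulrS expiD IH exprS.
Qed.

Lemma expi_pi : expi pi = -1.
Proof. by rewrite /expi cospi sinpi; apply/eqP; rewrite eq_complex /= oppr0 !eqxx. Qed.

Lemma expi_piMint (k : int) : expi (pi *~ k) = (-1) ^ k.
Proof.
case: k => n; first by rewrite /intmul /exprz expi_mulrn expi_pi.
by rewrite [LHS]expiN expi_mulrn expi_pi.
Qed.

(** Subtracting a multiple of [pi] leaves [0 <= y < pi] with exponential 1 or -1; then [sin y = 0],
    which forces [y = 0]. *)
Lemma expi_sqr_eq1 x : expi x ^+ 2 = 1 -> exists k : int, x = pi *~ k.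
Proof.
rewrite -expi_mulrn => E; pose k := Num.floor (x / pi).
pose y := x - pi *~ k; exists k.
have pi0 := @pi_gt0 R.
have y_ge0 : 0 <= y by rewrite subr_ge0 -mulrzl -ler_pdivlMr // ge_floor.
have y_lt : y < pi.
  have := floorD1_gt (x / pi); rewrite ltr_pdivrMr // intrD mulrDl mul1r.
  by rewrite mulrzl ltrBlDr addrC.
suff sy : sin y = 0.
  apply/eqP; rewrite -subr_eq0 -/y; apply: contraTT (lexx (0 : R)) => y0.
  by rewrite -ltNge -{2}sy sin_gt0_pi // lt_neqAle eq_sym y0 y_ge0.
have E2 : expi y ^+ 2 = 1.
  rewrite expiD exprMn -expi_mulrn E mul1r expiN expi_piMint exprVn.
  by case: (k) => n; rewrite /exprz ?exprVn -exprM mulnC exprM sqrrN !expr1n ?invr1.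
have : expi y = 1 \/ expi y = -1.
  by move/eqP: E2; rewrite sqrf_eq1 => /orP[] /eqP; [left|right].
by case; case=> //; rewrite ?oppr0.
Qed.

End Convergence.

(** * Spectral form of the transition matrix *)

Section Spectral.
Variables (N : nat) (G : finZmodType) (C : {set G}).
Hypotheses (N_gt1 : (1 < N)%N) (dvdGN : (#|G| %| N)%N).
Hypothesis C_sym : forall g, g \in C -> - g \in C.
Local Notation D := (dual N G).

Section Closed.
Variables (K : numClosedFieldType) (z : K).
Hypothesis prim_z : N.-primitive_root z.

Lemma norm_ev (f : {ffun G -> 'Z_N}) x : `|character_value z f x| = 1.
Proof.
apply/eqP; rewrite -(pexpr_eq1 (ltnW N_gt1)) // -normrX.
by rewrite (ev_expN prim_z) normr1.
Qed.

Lemma conj_ev (f : {ffun G -> 'Z_N}) x : f \in D ->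
  (character_value z f x)^* = character_value z f (- x).
Proof.
move=> fD; rewrite (evN N_gt1 prim_z) // invC_norm norm_ev.
by rewrite expr1n invr1 mul1r.
Qed.

Lemma mem_oppE x : (- x \in C) = (x \in C).
Proof. by apply/idP/idP => /C_sym //; rewrite opprK. Qed.

Lemma fourierN (f : {ffun G -> 'Z_N}) : f \in D ->
  fourier z C (- f) = fourier z C f.
Proof.
move=> fD; rewrite /fourier [RHS](reindex_inj oppr_inj) /=.
rewrite [RHS](eq_bigl _ _ mem_oppE); apply: eq_bigr => c _.
by rewrite (evNl N_gt1 prim_z) (evN N_gt1 prim_z).
Qed.

Lemma fourier_real (f : {ffun G -> 'Z_N}) : f \in D ->
  fourier z C f \is Num.real.
Proof.
move=> fD; apply/CrealP; rewrite -[RHS]fourierN // rmorph_sum.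
by apply: eq_bigr => c _; rewrite [LHS]conj_ev // (evNl N_gt1 prim_z) (evN N_gt1 prim_z).
Qed.

Lemma adjacency_eigenvector (f : {ffun G -> 'Z_N}) u : f \in D ->
  \sum_w adjacency K (cayley_graph C) (enum_rank u) (enum_rank w) *
    character_value z f w = fourier z C f * character_value z f u.
Proof.
move=> fD; rewrite (reindex_inj (addrI u)) /= /fourier mulr_suml big_mkcond /=.
rewrite [RHS]big_mkcond /=; apply: eq_bigr => c _.
rewrite mxE !enum_rankK /cayley_graph addrC addKr.
by case: ifP => _; rewrite ?mul0r // mul1r (evD N_gt1 prim_z) // mulrC.
Qed.

(** Induction on [k]: orthogonality over the dual gives the identity matrix, and each further factor
    multiplies a character by its eigenvalue. The scalar [l] becomes [it] in the exponential
    series. *)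
Lemma spectral_expX (l : K) k u v :
  ((l *: adjacency K (cayley_graph C)) ^+ k) (enum_rank u) (enum_rank v) =
  #|G|%:R^-1 * \sum_(f in D)
    (l * fourier z C f) ^+ k * character_value z f (u - v).
Proof.
have n0 : #|G|%:R != 0 :> K by rewrite pnatr_eq0 -lt0n; apply/card_gt0P; exists u.
elim: k u => [|k IH] u.
  under eq_bigr do rewrite expr0 mul1r.
  rewrite (sum_ev_dual N_gt1 dvdGN prim_z) subr_eq0 card_dual //.
  rewrite expr0 -[1]/1%:M mxE (inj_eq enum_rank_inj).
  by case: eqP; rewrite ?mulVf ?mulr0.
rewrite exprS -[_ * _]/(_ *m _) mxE (reindex (@enum_rank G)) /=; last first.
  exact/onW_bij/enum_rank_bij.
under eq_bigr do rewrite IH mulrCA mulr_sumr.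
rewrite -mulr_sumr exchange_big; congr (_ * _); apply: eq_bigr => f fD.
under eq_bigr do rewrite mxE (evD N_gt1 prim_z) // -mulrA mulrCA !mulrA.
rewrite (evD N_gt1 prim_z) // exprS.
transitivity (l * (l * fourier z C f) ^+ k * character_value z f (- v) *
  (\sum_w adjacency K (cayley_graph C) (enum_rank u) (enum_rank w) *
    character_value z f w)).
  by rewrite [RHS]mulr_sumr; apply: eq_bigr => w _; ring.
by rewrite adjacency_eigenvector //; ring.
Qed.

End Closed.

Variables (R : realType) (z : R[i]).
Hypothesis prim_z : N.-primitive_root z.
Local Notation K := (Num.NumField.sort (R[i] : numFieldType)).
Local Notation ReF f := (complex.Re (fourier z C f)).

Lemma transition_entry t u v :
  transition (cayley_graph C) t (enum_rank u) (enum_rank v) =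
  #|G|%:R^-1 * \sum_(f in D) expi (t * ReF f) * character_value z f (u - v).
Proof.
pose E (x y : G) := #|G|%:R^-1 *
  \sum_(f in D) expi (t * ReF f) * character_value z f (x - y).
rewrite /transition /expmx (limn_mx_entries (M :=
  \matrix_(i, j) (E (enum_val i) (enum_val j)))) ?mxE ?enum_rankK // => i j.
rewrite mxE -(enum_valK i) -(enum_valK j) !enum_rankK.
move: (enum_val i) (enum_val j) => {i j u v} u v.
(* Each entry of the matrix series is a finite combination of scalar exponential series, whose
   limits are known. *)
rewrite (_ : (fun k => _) = fun k => #|G|%:R^-1 * \sum_(f in D)
    series (fun k => ('i%C * (t * ReF f)%:C%C) ^+ k / k`!%:R : K) k *
    character_value z f (u - v)).
  apply: cvgMr; apply: cvg_big => [|f _]; first exact: add_continuous.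
  by apply: cvgMl; exact: cvg_expi.
apply/funext => n; rewrite /series /= summxE.
have scaleE (c : R[i]) (M : 'M[R[i]]_#|G|) i j : (c *: M) i j = c * M i j.
  by rewrite mxE.
transitivity (\sum_(0 <= k < n) #|G|%:R^-1 * (k`!%:R^-1 * \sum_(f in D)
    ('i%C * t%:C%C * fourier z C f) ^+ k * character_value z f (u - v))).
  by apply: eq_bigr => k _; rewrite [LHS]scaleE (spectral_expX prim_z) mulrCA.
rewrite -mulr_sumr; congr (_ * _).
under [RHS]eq_bigr do rewrite mulr_suml.
rewrite [RHS]exchange_big; apply: eq_bigr => k _.
rewrite mulr_sumr; apply: eq_bigr => f fD.
have -> : (t * ReF f)%:C%C = t%:C%C * fourier z C f.
  by rewrite [LHS]rmorphM /= RRe_real ?(fourier_real prim_z).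
by rewrite !mulrA; congr (_ * _); apply: mulrC.
Qed.

Lemma pst_spectral :
  perfect_state_transfer R (cayley_graph C) <->
  exists t (a : G), a != 0 /\ forall f, f \in D ->
    character_value z f a * expi (t * ReF f) = expi (t * ReF (0 : {ffun G -> 'Z_N})).
Proof.
have n0 : #|G|%:R != 0 :> R[i] by rewrite pnatr_eq0 -lt0n; apply/card_gt0P; exists 0.
split=> [[t [u [v [uv]]]] | [t [a [a0 H]]]].
  rewrite transition_entry => H.
  exists t, (u - v); split; first by rewrite subr_eq0.
  (* Equality in the triangle inequality makes all terms equal; the trivial character then
     identifies their common value. *)
  have [||c _ Hc] := @normC_sum_eq1 _ _ (fun f => f \in D)
      (fun f => expi (t * ReF f) * character_value z f (u - v)).
  - rewrite [RHS](eq_bigr (fun=> 1)) => [|f _]; last first.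
      by rewrite normrM norm_expi norm_ev ?mul1r.
    rewrite sumr_const card_dual //.
    by rewrite -[X in `|X|](mulVKf n0) normrM H mulr1 normr_nat.
  - by move=> f _; rewrite normrM norm_expi norm_ev ?mul1r.
  move=> f fD; rewrite mulrC (Hc _ fD) -(Hc _ (dual0 N G)).
  by rewrite ev0l mulr1.
exists t, a, 0; split=> //; rewrite transition_entry subr0.
rewrite (eq_bigr (fun=> expi (t * ReF (0 : {ffun G -> 'Z_N})))) => [|f fD]; last by rewrite mulrC H.
by rewrite sumr_const card_dual // -[X in _ * X]mulr_natl mulKf // norm_expi.
Qed.

End Spectral.

Lemma Aint_ev (N : nat) (G : finZmodType) (z : algC) (f : {ffun G -> 'Z_N}) x :
  N.-primitive_root z -> character_value z f x \in Aint.
Proof. by move=> prim_z; rewrite rpredX // (Aint_prim_root prim_z). Qed.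

Lemma sign_exprz (K : numFieldType) (k : int) : ((-1) ^ k == 1 :> K) = ~~ odd `|k|.
Proof.
have E : (-1) ^ k = (-1) ^+ `|k| :> K.
  by case: k => n //; rewrite NegzE abszN absz_nat -[RHS]invr_sign.
rewrite E -signr_odd; case: odd => /=; rewrite ?eqxx //.
by rewrite eq_sym -subr_eq0 opprK (pnatr_eq0 K 2).
Qed.

(** * Integrality of the eigenvalues under perfect state transfer *)

Section Forward.
Variables (R : realType) (N : nat) (G : finZmodType) (C : {set G}) (zA : algC).
Hypotheses (N_gt1 : (1 < N)%N) (dvdGN : (#|G| %| N)%N).
Hypothesis prim_zA : N.-primitive_root zA.
Hypothesis C_sym : forall g, g \in C -> - g \in C.
Hypothesis C_irrefl : 0 \notin C.
Local Notation D := (dual N G).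

(* The phases pi q_f are integer multiples of one real number; the vanishing
   of the trace makes that number rational, so the eigenvalues are rational,
   hence integers. *)
Lemma pst_congruence : perfect_state_transfer R (cayley_graph C) ->
  exists (a : G) (M : int) (e : {ffun G -> 'Z_N} -> int),
    [/\ a != 0, a + a = 0, M != 0 & forall f, f \in D ->
      fourier zA C f = (#|C|%:Z + M * e f)%:~R /\ odd `|e f| = (f a != 0)].
Proof.
have [z [prim_z ratE]] := conjugate_root_of_unity R[i] prim_zA.
case/(pst_spectral N_gt1 dvdGN C_sym prim_z) => t [a [a0 H]].
pose r f := complex.Re (@fourier _ z N G C f).
have rE f : f \in D -> (r f)%:C%C = fourier z C f.
  by move=> fD; rewrite RRe_real ?(fourier_real N_gt1 C_sym prim_z).
have r0 : r 0 = #|C|%:R.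
  apply: complexI; rewrite rE ?dual0 // /fourier.
  under eq_bigr do rewrite ev0l.
  by rewrite sumr_const rmorph_nat.
(* The characters [f] and [- f] have the same eigenvalue, so the phase condition gives them the same
   value at [a]. *)
have ev2 f : f \in D -> character_value z f a ^+ 2 = 1.
  move=> fD; have := H _ (dualN fD); rewrite -(H f fD).
  rewrite (fourierN N_gt1 C_sym prim_z) // => /(mulIf (expi_neq0 _)).
  rewrite (evNl N_gt1 prim_z) => E.
  by rewrite expr2 -{1}E mulVf ?(ev_neq0 N_gt1 prim_z).
have aa0 : a + a = 0.
  apply: (ev_separates N_gt1 dvdGN prim_z) => f fD.
  by rewrite (evD N_gt1 prim_z) // -expr2 ev2.
have phase f : f \in D -> expi (t * (r f - r 0)) = character_value z f a.
  move=> fD; apply: (mulfI (expi_neq0 (t * r 0))).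
  rewrite -expiD -mulrDr [r 0 + _]addrC subrK -{1}(H f fD) mulrAC.
  by rewrite -expr2 ev2 // mul1r.
have /choice [q qE] f : exists k : int, f \in D -> t * (r f - r 0) = pi *~ k.
  have [fD | fND] := boolP (f \in D); last by exists 0.
  have phase2 : expi (t * (r f - r 0)) ^+ 2 = 1 by rewrite phase // ev2.
  by have [k kE] := expi_sqr_eq1 phase2; exists k.
have q_odd f : f \in D -> odd `|q f| = (f a != 0).
  move=> fD; rewrite -(ev_eq1 N_gt1 prim_z) -(phase f fD) qE // expi_piMint.
  by rewrite sign_exprz negbK.
have [f1 f1D f1a] := dual_separates N_gt1 dvdGN a0.
have t0 : t != 0.
  apply/eqP => t0; have := phase _ f1D; rewrite t0 mul0r expi0 => /esym/eqP.
  by rewrite (ev_eq1 N_gt1 prim_z) (negPf f1a).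
have pi0 : pi != 0 :> R by rewrite gt_eqF ?pi_gt0.
have rq f : f \in D -> r f = #|C|%:R + pi / t * (q f)%:~R.
  move=> fD; rewrite -r0; apply: (mulfI t0); apply/eqP.
  rewrite -subr_eq0 mulrDr opprD addrA -mulrBr qE // mulrA [t * _]mulrC divfK //.
  by rewrite -mulrzr subrr.
(* The eigenvalues sum to the trace of the adjacency matrix, which is 0 because 0 is not in [C]. *)
have sum_r : \sum_(f in D) r f = 0.
  apply: complexI; rewrite rmorph_sum rmorph0.
  transitivity (\sum_(f in D) fourier z C f).
    by apply: eq_bigr => f fD; rewrite -rE.
  rewrite exchange_big big1 // => c cC.
  rewrite (sum_ev_dual N_gt1 dvdGN prim_z); case: eqP => // c0.
  by move: C_irrefl; rewrite -c0 cC.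
have sum_rq : #|G|%:R * #|C|%:R + pi / t * (\sum_(f in D) q f)%:~R = 0 :> R.
  rewrite -sum_r rmorph_sum mulr_sumr (eq_bigr _ rq) big_split /=.
  by rewrite sumr_const card_dual // mulr_natl.
(* Otherwise the trace relation makes [C] empty, so all eigenvalues vanish and [q f1] is 0, although
   it is odd. *)
have Q0 : \sum_(f in D) q f != 0.
  apply/eqP => Q0; move/eqP: sum_rq.
  rewrite Q0 mulr0 addr0 -natrM pnatr_eq0 muln_eq0.
  case/orP; first by apply/negP; rewrite -lt0n; apply/card_gt0P; exists 0.
  rewrite cards_eq0 => /eqP C0.
  have := rq _ f1D; rewrite /r C0 /fourier !big_set0 cards0 add0r => /esym/eqP.
  rewrite !mulf_eq0 invr_eq0 (negPf pi0) (negPf t0) /= intr_eq0 => /eqP q0.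
  by have := q_odd _ f1D; rewrite q0 f1a.
pose rho : rat := - (#|G|%:R * #|C|%:R) / (\sum_(f in D) q f)%:~R.
have rhoE : pi / t = ratr rho.
  rewrite /rho fmorph_div rmorphN rmorphM !rmorph_nat rmorph_int.
  by apply: (canRL (mulfK _)); rewrite ?intr_eq0 //; apply/eqP;
  rewrite -subr_eq0 opprK addrC sum_rq.
clearbody rho.
have rho0 : rho != 0.
  apply/eqP => rho0; move/eqP: rhoE; rewrite rho0 rmorph0 mulf_eq0 invr_eq0.
  by rewrite (negPf pi0) (negPf t0).
have fA f : f \in D -> fourier zA C f = ratr (#|C|%:R + rho * (q f)%:~R).
  move=> fD; apply/eqP; rewrite -ratE -rE // rq // rhoE.
  rewrite (_ : _ + _ = ratr (#|C|%:R + rho * (q f)%:~R)) ?fmorph_rat //.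
  by rewrite rmorphD rmorphM rmorph_nat rmorph_int.
have int_rho f : f \in D -> exists k : int, rho * (q f)%:~R = k%:~R.
  move=> fD; have : fourier zA C f \in Num.int.
    apply: Cint_rat_Aint; first by rewrite fA // Crat_rat.
    by apply: rpred_sum => c _; apply: Aint_ev.
  rewrite fA // => /intrP[k kE]; exists (k - #|C|%:Z).
  have : ratr (#|C|%:R + rho * (q f)%:~R) = ratr k%:~R :> algC.
    by rewrite kE rmorph_int.
  by move/fmorph_inj; rewrite intrB => <-; rewrite addrC addKr.
have den_dvd f : f \in D -> (denq rho %| q f)%Z.
  move=> fD; have [k kE] := int_rho f fD.
  have : numq rho * q f = k * denq rho.
    by apply: (@intr_inj rat); rewrite !intrM -kE numqE mulrAC.
  move=> E; rewrite -(Gauss_dvdzr _ (m := denq rho) (n := numq rho)).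
    by rewrite E dvdz_mull.
  by rewrite coprimezE coprime_sym coprime_num_den.
(* In lowest terms [rho * q f] is [numq rho] times [q f / denq rho]. The denominator divides the odd
   [q f1], so it is odd and the quotients keep the parities of the [q f]. *)
exists a, (numq rho), (fun f => (q f %/ denq rho)%Z).
split=> //; first by rewrite numq_eq0.
have den_odd : odd `|denq rho|.
  apply: contraTT f1a => den_even; rewrite negbK; apply: contraTT den_even => f1a.
  have : odd `|q f1| by rewrite q_odd.
  by rewrite -(divzK (den_dvd _ f1D)) abszM oddM negbK => /andP[].
move=> f fD; split.
  rewrite fA // -[RHS](@ratr_int algC) intrD intrM.
  congr (ratr (_ + _)); rewrite -{1}(divzK (den_dvd _ fD)) numqE intrM; ring.
by rewrite -q_odd // -{2}(divzK (den_dvd _ fD)) abszM oddM den_odd andbT.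
Qed.

End Forward.

(** * Power-closed sets *)

(** Take [k + o * j] with [j] the part of [N] prime to [k]: each prime divisor of [N] divides
    exactly one of [k] and [o * j]. *)
Lemma coprime_lift (o N k : nat) : (0 < N)%N -> coprime k o ->
  exists2 k', coprime k' N & k' = k %[mod o].
Proof.
(* If [k = 0] then [o = 1], and [k + o] replaces it; [\pi(0)] is empty and would spoil the choice of
   [j]. *)
move=> N0; wlog k0 : k / (0 < k)%N => [W ko|].
  have [||k' k'N k'k] := W (k + o)%N.
  - by case: k ko {W} => // /eqP; rewrite gcd0n => ->.
  - by rewrite coprime_sym /coprime gcdnDr gcdnC.
  by exists k' => //; rewrite k'k modnDr.
move=> ko; pose j := (N`_(\pi(k)^'))%N; exists (k + o * j)%N.
  have kj0 : (0 < k + o * j)%N by rewrite addn_gt0 k0.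
  rewrite coprime_has_primes //; apply/hasPn => p.
  rewrite mem_primes => /and3P[pr_p _ pN]; rewrite mem_primes pr_p kj0 /=.
  have [pk | pk] := boolP (p %| k)%N.
    rewrite dvdn_addr // Euclid_dvdM // negb_or -prime_coprime //.
    rewrite (coprime_dvdl pk ko) /=; apply: contraL pk => pj.
    have := part_pnat (\pi(k)^') N => /pnatP-/(_ (part_gt0 _ _) _ pr_p pj).
    by rewrite !inE /= mem_primes pr_p k0.
  rewrite addnC dvdn_addr // dvdn_mull //.
  have pp : (\pi(k)^').-nat p.
    by rewrite pnatE // !inE /= mem_primes pr_p k0.
  by rewrite -(part_pnat_id pp) partn_dvd.
by rewrite addnC mulnC modnMDl.
Qed.

Definition power_stable (G : finZmodType) (C : {set G}) : Prop :=
  forall g h : G, <[g]>%g = <[h]>%g -> g \in C -> h \in C.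

Lemma power_closedP (G : finZmodType) (C : {set G}) :
  power_closed C <-> power_stable C.
Proof.
split=> [[P sP ->] g h gh /bigcupP[B BP gB] | C_st].
  apply/bigcupP; exists B => //; move/fintype.subsetP/(_ _ BP)/imsetP: sP => [x _ Bx].
  by move: gB; rewrite Bx !inE gh.
exists [set power_class g | g in C].
  by apply/fintype.subsetP => _ /imsetP[g gC ->]; apply: imset_f; rewrite inE.
apply/setP => h; apply/idP/bigcupP => [hC | [_ /imsetP[g gC ->]]].
  by exists (power_class h); [apply: imset_f | rewrite inE].
by rewrite inE => /eqP gh; apply: C_st gC.
Qed.

(** * Rational Fourier sums and the Galois action *)

Section Inversion.
Variables (N : nat) (G : finZmodType) (F : numFieldType) (z : F).
Hypotheses (N_gt1 : (1 < N)%N) (dvdGN : (#|G| %| N)%N).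
Hypothesis prim_z : N.-primitive_root z.
Local Notation D := (dual N G).

Lemma fourier_inversion (A : {set G}) x :
  \sum_(f in D) fourier z A f * character_value z f (- x) =
  (if x \in A then #|G|%:R else 0).
Proof.
under eq_bigr => f fD.
  rewrite mulr_suml; under eq_bigr do rewrite -(evD N_gt1 prim_z) //.
  over.
rewrite exchange_big /=.
under eq_bigr do rewrite (sum_ev_dual N_gt1 dvdGN prim_z) subr_eq0 card_dual //.
rewrite -big_mkcondr /=; case: ifP => xA.
  by rewrite (big_pred1 x) // => c /=; case: eqP => [->|]; rewrite ?xA ?andbF.
by rewrite big_pred0 // => c; case: eqP => [->|]; rewrite ?xA ?andbF.
Qed.

Lemma fourier_inj (A B : {set G}) :
  (forall f, f \in D -> fourier z A f = fourier z B f) -> A = B.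
Proof.
move=> AB; have n0 : #|G|%:R != 0 :> F.
  by rewrite pnatr_eq0 -lt0n; apply/card_gt0P; exists 0.
apply/setP => x; have : (if x \in A then #|G|%:R else 0) =
    (if x \in B then #|G|%:R else 0) :> F.
  by rewrite -!fourier_inversion; apply: eq_bigr => f fD; rewrite AB.
by do 2![case: ifP] => // _ _ /eqP; rewrite 1?[0 == _]eq_sym (negPf n0).
Qed.

End Inversion.

(** Write [h = k g] with [k] prime to the order of [g] and lift [k] to [k'] prime to [N]. The
    automorphism raising [N]-th roots of unity to the power [k'] fixes the rational Fourier sums of
    [C] and sends them to those of [k' C]; by Fourier inversion the two sets agree. *)
Lemma rational_power_stable (N : nat) (G : finZmodType) (C : {set G})
    (z : algC) : (1 < N)%N -> (#|G| %| N)%N -> N.-primitive_root z ->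
  (forall f : {ffun G -> 'Z_N}, f \in dual N G -> fourier z C f \in Crat) ->
  power_stable C.
Proof.
move=> N_gt1 dvdGN prim_z rat_C g h gh gC.
have orderN (x : G) : (#[x]%g %| N)%N.
  by apply: dvdn_trans dvdGN; rewrite -cardsT order_dvdG ?inE.
have [k hk] : exists k, h = g *+ k.
  by have /cycleP[k ->] : h \in <[g]>%g; [rewrite gh cycle_id | exists k; rewrite FinRing.zmodXgE].
have ko : coprime k #[g]%g.
  have : generator <[g]>%g (g ^+ k)%g by rewrite /generator FinRing.zmodXgE -hk gh.
  by rewrite generator_coprime coprime_sym.
have [k' k'N k'k] := coprime_lift (ltnW N_gt1) ko.
have {}hk : h = g *+ k'.
  by rewrite hk -!FinRing.zmodXgE -[RHS]expg_mod_order k'k expg_mod_order.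
have [u uE] := Qn_aut_exists k'N.
have inj_k : injective (fun x : G => x *+ k').
  move=> x y xy; apply/eqP; rewrite -subr_eq0.
  have : (#[(x - y)%R]%g %| k')%N by rewrite order_dvdn FinRing.zmodXgE mulrnBl xy subrr.
  move=> dk; have := coprime_dvdl dk (coprime_dvdr (orderN (x - y)%R) k'N).
  by rewrite /coprime gcdnn order_eq1.
suff CE : C = [set c *+ k' | c in C].
  by rewrite CE; apply/imsetP; exists g.
apply: (fourier_inj N_gt1 dvdGN prim_z) => f fD.
rewrite /fourier [RHS]big_imset /=; last by move=> x y _ _; apply: inj_k.
have /CratP[q qE] := rat_C f fD.
transitivity (u (fourier z C f)); first by rewrite -[LHS]/(fourier z C f) qE fmorph_rat.
rewrite rmorph_sum; apply: eq_bigr => c _.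
by rewrite /= uE ?(ev_expN prim_z) // (evMn N_gt1 prim_z).
Qed.

(** * Groups with cyclic Sylow 2-subgroup *)

Section CyclicSylow.
Variables (G : finZmodType) (d m : nat).
Hypotheses (odd_m : odd m) (cardG : #|G| = (2 ^ d * m)%N).
Hypothesis cyclic_Sylow2 :
  forall P : {group G}, (2.-Sylow([set: G]) P)%g -> cyclic P.
Implicit Types (g h q x y : G).

Lemma order_addE x k : (#[x]%g %| k)%N = (x *+ k == 0).
Proof. exact: order_dvdn. Qed.

Lemma order_dvd_card x : (#[x]%g %| 2 ^ d * m)%N.
Proof. by rewrite -cardG -cardsT order_dvdG ?inE. Qed.

Lemma cycle_eq_mulrn x y : <[x]>%g = <[y]>%g ->
  exists2 k, coprime #[x]%g k & y = x *+ k.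
Proof.
move=> xy; have /cycleP[k yE] : y \in <[x]>%g by rewrite xy cycle_id.
by exists k => //; rewrite -generator_coprime -yE /generator xy.
Qed.

Lemma cycle_mulrn x k : coprime #[x]%g k -> <[x]>%g = <[x *+ k]>%g.
Proof. by rewrite -generator_coprime => /eqP. Qed.

(** The Sylow 2-subgroup as the kernel of multiplication by [2 ^ d], so that membership is an
    equation. *)
Definition Sylow2 : {set G} := [set x | x *+ 2 ^ d == 0].

Lemma Sylow2P (P : {group G}) : (2.-Sylow([set: G]) P)%g -> P = Sylow2 :> {set G}.
Proof.
move=> sylP; have abG : abelian [set: G] by apply/centsP => g _ h _; apply: addrC.
have nP : normal P [set: G] by rewrite -sub_abelian_normal // finset.subsetT.
apply/setP => x; rewrite (mem_normal_Hall sylP) ?inE // -order_addE.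
rewrite /p_elt; apply/idP/idP => [px | /pnat_dvd-> //]; last first.
  by rewrite pnatX pnat_id.
rewrite -(part_pnat_id px).
have -> : (2 ^ d = (2 ^ d * m)`_2)%N.
  rewrite partnM ?expn_gt0 // ?odd_gt0 // part_pnat_id ?pnatX ?pnat_id //.
  by rewrite part_p'nat ?muln1 // p'natE // dvdn2 odd_m.
by rewrite partn_dvd ?order_dvd_card // -cardG; apply/card_gt0P; exists x.
Qed.

Lemma card_Sylow2 : #|Sylow2| = (2 ^ d)%N.
Proof.
have [P sylP] := Sylow_exists 2 [set: G]%G.
rewrite -(Sylow2P sylP) (card_Hall sylP) cardsT cardG.
rewrite partnM ?expn_gt0 // ?odd_gt0 // part_pnat_id ?pnatX ?pnat_id //.
by rewrite part_p'nat ?muln1 // p'natE // dvdn2 odd_m.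
Qed.

Lemma Sylow2_generator : exists2 x, #[x]%g = (2 ^ d)%N & Sylow2 = <[x]>%g.
Proof.
have [P sylP] := Sylow_exists 2 [set: G]%G.
have /cyclicP[x Px] := cyclic_Sylow2 sylP; exists x.
  by rewrite /order -Px (Sylow2P sylP) card_Sylow2.
by rewrite -(Sylow2P sylP).
Qed.

Lemma order_pow2_Sylow2 k x : #[x]%g = (2 ^ k)%N -> x \in Sylow2.
Proof.
move=> ox; have [P sylP] := Sylow_exists 2 [set: G]%G.
have abG : abelian [set: G] by apply/centsP => g _ h _; apply: addrC.
rewrite -(Sylow2P sylP) (mem_normal_Hall sylP) ?inE //.
  by rewrite /p_elt ox pnatX pnat_id.
by rewrite -sub_abelian_normal // finset.subsetT.
Qed.

Lemma Sylow2_order x : x \in Sylow2 -> exists k, #[x]%g = (2 ^ k)%N.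
Proof.
rewrite inE -order_addE => /dvdn_pfactor-/(_ isT)[k _ ->].
by exists k.
Qed.

(** Both cycles lie in the cyclic Sylow 2-subgroup, whose subgroups are determined by their
    orders. *)
Lemma cycle_eq_order_pow2 k x y :
  #[x]%g = (2 ^ k)%N -> #[y]%g = (2 ^ k)%N -> <[x]>%g = <[y]>%g.
Proof.
move=> ox oy; have [P sylP] := Sylow_exists 2 [set: G]%G.
apply/eqP; rewrite (eq_subG_cyclic (cyclic_Sylow2 sylP)).
- by rewrite -!/(order _) ox oy.
- by rewrite cycle_subG (Sylow2P sylP) (order_pow2_Sylow2 ox).
- by rewrite cycle_subG (Sylow2P sylP) (order_pow2_Sylow2 oy).
Qed.

Lemma order2_unique x y : #[x]%g = 2%N -> #[y]%g = 2%N -> x = y.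
Proof.
move=> ox oy.
have [k] := cycle_eq_mulrn (@cycle_eq_order_pow2 1 x y ox oy).
rewrite ox coprime2n => ok ->; rewrite -(odd_double_half k) ok -mul2n.
by rewrite mulrnDr mulrnA -[x *+ 2]/(x ^+ 2)%g -ox expg_order mul0rn addr0.
Qed.

Lemma order4_unique x y : #[x]%g = 4%N -> #[y]%g = 4%N -> y = x \/ y = - x.
Proof.
move=> ox oy.
have [k] := cycle_eq_mulrn (@cycle_eq_order_pow2 2 x y ox oy).
have x4 : x *+ 4 = 0 by rewrite -[LHS]/(x ^+ 4)%g -ox expg_order.
rewrite ox (@coprime_pexpl 2 2 k) // coprime2n => ok ->.
rewrite (divn_eq k 4) mulrnDr mulnC mulrnA x4 mul0rn add0r.
have : odd (k %% 4) by lia.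
have : (k %% 4 < 4)%N by rewrite ltn_mod.
case: (k %% 4)%N => [|[|[|[|]]]] // _ _; [by left | right].
by apply/eqP; rewrite -addr_eq0 addrC -mulrS x4.
Qed.

Lemma exists_order_pow2 k : (k <= d)%N -> exists x : G, #[x]%g = (2 ^ k)%N.
Proof.
move=> kd; have [x ox _] := Sylow2_generator; exists (x *+ 2 ^ (d - k)).
rewrite -[x *+ _]/(x ^+ _)%g orderXdiv ox ?dvdn_exp2l ?leq_subr //.
by rewrite -expnB ?leq_subr // subKn.
Qed.

(** By uniqueness [a] is [g] times half its order, and one plus half an order divisible by 4 is
    prime to that order. *)
Lemma cycle_addr_order2 a g : #[a]%g = 2%N -> (4 %| #[g]%g)%N ->
  <[g]>%g = <[g + a]>%g.
Proof.
move=> oa /dvdnP[j ogj].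
have j0 : (0 < j)%N by case: j ogj (order_gt0 g) => // ->.
have <- : g *+ (2 * j) = a.
  apply: order2_unique => //; rewrite -[g *+ _]/(g ^+ _)%g orderXdiv ogj.
    by rewrite (_ : j * 4 = 2 * (2 * j))%N ?mulnK //; lia.
  by apply/dvdnP; exists 2; lia.
rewrite -mulrS; apply: cycle_mulrn.
rewrite ogj coprimeMl (@coprime_pexpl 2 2) // coprime2n /= mul2n odd_double andbT.
by rewrite -mul2n -addn1 /coprime gcdnMDl gcdn1.
Qed.

(** Here [b] is [g] times one or three quarters of its order; adding one gives a factor prime to an
    order divisible by 8. *)
Lemma cycle_addr_order4 b g : #[b]%g = 4%N -> (8 %| #[g]%g)%N ->
  <[g]>%g = <[g + b]>%g.
Proof.
move=> ob /dvdnP[j ogj].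
have j0 : (0 < j)%N by case: j ogj (order_gt0 g) => // ->.
have o4 : #[g *+ (2 * j)]%g = 4%N.
  rewrite -[g *+ _]/(g ^+ _)%g orderXdiv ogj.
    by rewrite (_ : j * 8 = 4 * (2 * j))%N ?mulnK //; lia.
  by apply/dvdnP; exists 4; lia.
have [i bE] : exists i, b = g *+ (2 * (i * j)).
  have [-> | ->] := order4_unique o4 ob; first by exists 1%N; rewrite mul1n.
  exists 3; apply/esym/eqP; rewrite -addr_eq0 -mulrnDr.
  by rewrite -order_addE ogj; apply/dvdnP; exists 1%N; lia.
rewrite bE -mulrS; apply: cycle_mulrn.
rewrite ogj coprimeMl (@coprime_pexpl 3 2) // coprime2n /= mul2n odd_double andbT.
by rewrite -mul2n -addn1 mulnA /coprime gcdnMDl gcdn1.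
Qed.

Lemma coprime_odd_pow2 h q k : odd #[h]%g -> #[q]%g = (2 ^ k)%N ->
  coprime #[h]%g #[q]%g.
Proof. by move=> oh ->; rewrite coprimeXr // coprimen2. Qed.

Lemma order_oddD h q k : odd #[h]%g -> #[q]%g = (2 ^ k)%N ->
  #[h + q]%g = (#[h]%g * 2 ^ k)%N.
Proof.
move=> oh oq; rewrite -oq -[h + q]/(h * q)%g orderM //; first exact: addrC.
exact: coprime_odd_pow2 oq.
Qed.

Lemma cycle_oddD h h' q q' k : odd #[h]%g -> #[q]%g = (2 ^ k)%N ->
  <[h]>%g = <[h']>%g -> <[q]>%g = <[q']>%g -> <[h + q]>%g = <[h' + q']>%g.
Proof.
move=> oh oq hh qq.
have oq' : #[q']%g = (2 ^ k)%N by rewrite /order -qq -oq.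
have oh' : odd #[h']%g by rewrite /order -hh.
rewrite -[h + q]/(h * q)%g -[h' + q']/(h' * q')%g.
rewrite !cycleM ?hh ?qq //;
  first [exact: addrC | exact: coprime_odd_pow2 oq | exact: coprime_odd_pow2 oq'].
Qed.

Lemma odd_pow2_decomposition g : exists h q k,
  [/\ g = h + q, odd #[h]%g, #[q]%g = (2 ^ k)%N & #[g]%g = (#[h]%g * 2 ^ k)%N].
Proof.
have oq : #[g.`_2]%g = (2 ^ logn 2 #[g]%g)%N by rewrite order_constt p_part.
have oh : odd #[constt g (2%N)^']%g.
  by rewrite order_constt -[odd _]negbK -dvdn2 -p'natE // part_pnat.
exists (constt g (2%N)^'), (g.`_2)%g, (logn 2 #[g]%g).
have gE : g = constt g (2%N)^' + (g.`_2)%g.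
  by rewrite addrC -[LHS](consttC 2%N).
by split=> //; rewrite {1}gE (order_oddD oh oq).
Qed.

Lemma odd_order_double h k : odd #[h]%g -> <[h]>%g = <[h *+ 2 ^ k]>%g.
Proof. by move=> oh; apply: cycle_mulrn; rewrite coprimeXr // coprimen2. Qed.

(** Multiplication by a power of 2 is invertible on the cycle of [h], which has odd order. *)
Lemma odd_order_halve h k : odd #[h]%g ->
  exists2 h', <[h']>%g = <[h]>%g & h = h' *+ 2 ^ k.
Proof.
move=> oh; have /cycleP[i hE] : h \in <[h *+ 2 ^ k]>%g.
  by rewrite -odd_order_double // cycle_id.
exists (h *+ i); last by rewrite -mulrnA mulnC mulrnA.
apply/esym/cycle_mulrn.
have : coprime #[h *+ 2 ^ k]%g i.
  by rewrite -generator_coprime /generator -hE -odd_order_double.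
by rewrite /order -odd_order_double.
Qed.

End CyclicSylow.

(** * Necessity *)

(** The quotient [x / M] is rational and an algebraic integer, hence an integer. *)
Lemma Aint_dvdz (M x : int) (y : algC) : M != 0 -> y \in Aint ->
  x%:~R = M%:~R * y -> (M %| x)%Z.
Proof.
move=> M0 yA E; have M0' : M%:~R != 0 :> algC by rewrite intr_eq0.
have yE : y = x%:~R / M%:~R by rewrite E mulrC mulKf.
have /intrP[k kE] : y \in Num.int.
  by apply: Cint_rat_Aint; rewrite // yE rpred_div // rpred_int.
apply/dvdzP; exists k; apply: (@intr_inj algC).
by rewrite intrM -kE mulrC.
Qed.

(** * Partial Fourier inversion on cosets of the Sylow 2-subgroup *)

Section PartialInversion.
Variables (G : finZmodType) (d m N : nat) (C : {set G}) (z : algC) (a : G).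
Hypotheses (odd_m : odd m) (cardG : #|G| = (2 ^ d * m)%N).
Hypothesis cyclic_Sylow2 :
  forall P : {group G}, (2.-Sylow([set: G]) P)%g -> cyclic P.
Hypotheses (N_gt1 : (1 < N)%N) (dvdGN : (#|G| %| N)%N).
Hypothesis prim_z : N.-primitive_root z.
Hypotheses (oa : #[a]%g = 2%N) (stC : power_stable C).
Local Notation D := (dual N G).
Local Notation P := (Sylow2 G d).
Local Notation ev := (character_value z).

Definition annihilator : {set {ffun G -> 'Z_N}} :=
  [set f in D | [forall x in P, f x == 0]].

Lemma annihilatorP f : reflect (f \in D /\ forall x, x \in P -> f x = 0)
  (f \in annihilator).
Proof.
apply: (iffP idP) => [|[fD fP]]; rewrite finset.in_set.
  by move=> /andP[fD /forall_inP fP]; split=> // x /fP/eqP.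
by apply/andP; split=> //; apply/forall_inP => x xP; rewrite fP.
Qed.

Lemma annihilatorB f h : f \in annihilator -> h \in annihilator ->
  f - h \in annihilator.
Proof.
move=> /annihilatorP[fD fP] /annihilatorP[hD hP]; apply/annihilatorP.
by split=> [|x xP]; rewrite ?dualD ?dualN // !ffunE fP ?hP // subr0.
Qed.

Lemma annihilatorD f h : f \in annihilator -> h \in annihilator ->
  f + h \in annihilator.
Proof.
move=> fA hA; rewrite -[h]opprK annihilatorB // -sub0r annihilatorB //.
by rewrite -(subrr h) annihilatorB.
Qed.

(** For [x] outside [P] some [h] separates [2 ^ d x] from 0; its multiple [2 ^ d h] annihilates [P]
    and is still nontrivial at [x]. *)
Lemma sum_annihilator x :
  \sum_(f in annihilator) ev f x = (if x \in P then #|annihilator|%:R else 0).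
Proof.
case: ifPn => xP.
  rewrite (eq_bigr (fun=> 1)) ?sumr_const // => f /annihilatorP[_ fP].
  by rewrite /character_value fP ?expr0.
have [h hD hx] : exists2 h, h \in D & h (x *+ 2 ^ d) != 0.
  by apply: (dual_separates N_gt1 dvdGN); move: xP; rewrite inE.
have hA : h *+ 2 ^ d \in annihilator.
  apply/annihilatorP; split=> [|y]; first exact: dualMn.
  rewrite inE => /eqP y0; apply/eqP.
  rewrite -(ev_eq1 N_gt1 prim_z) (evMnl N_gt1 prim_z).
  by rewrite -(evMn N_gt1 prim_z) // y0 (ev0 N_gt1 prim_z).
apply: (@sum_twisted_eq0 _ _ _ (fun f => ev f x) _ (ev (h *+ 2 ^ d) x)
  (addIr (h *+ 2 ^ d))) => [f|f _|].
- apply/idP/idP => [fhA | fA]; last exact: annihilatorD.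
  by rewrite -(addrK (h *+ 2 ^ d) f) annihilatorB.
- exact: evDl.
- rewrite (evMnl N_gt1 prim_z) -(evMn N_gt1 prim_z) //.
  by rewrite (ev_eq1 N_gt1 prim_z).
Qed.

(** Summing the values of all annihilating characters in both orders shows that the annihilator has
    order [|G| / |P| = m]. *)
Lemma odd_annihilator : odd #|annihilator|.
Proof.
have E : (#|P| * #|annihilator| = #|G|)%N.
  apply/eqP; rewrite -(eqr_nat algC) natrM mulr_natl -sumr_const big_mkcond /=.
  rewrite -(eq_bigr _ (fun x _ => sum_annihilator x)) exchange_big /=.
  rewrite (bigD1 (0 : {ffun G -> 'Z_N})) /=; last first.
    by apply/annihilatorP; split=> [|x _]; rewrite ?dual0 ?ffunE.
  rewrite (sum_ev_group N_gt1 prim_z) ?dual0 // eqxx big1 ?addr0 //.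
  move=> f /andP[/annihilatorP[fD _] /negPf f0].
  by rewrite (sum_ev_group N_gt1 prim_z) // f0.
move: E; rewrite (card_Sylow2 odd_m cardG) cardG => /eqP.
by rewrite eqn_pmul2l ?expn_gt0 // => /eqP->.
Qed.

(** If [f] is nontrivial at [a], the odd multiple [m f] keeps the value -1 there and is trivial on
    what [m] kills. *)
Lemma odd_trivial_character : exists w, [/\ w \in D, ev w a = -1 &
  forall h, h *+ m = 0 -> ev w h = 1].
Proof.
have a0 : a != 0 by apply: contra_eq_neq oa => ->; rewrite order1.
have [f fD fa] := dual_separates N_gt1 dvdGN a0.
have a2 : a *+ 2 = 0 by apply/eqP; rewrite -order_addE oa.
exists (f *+ m); split=> [||h hm]; first exact: dualMn.
  rewrite (evMnl N_gt1 prim_z).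
  have : ev f a ^+ 2 == 1 by rewrite -(evMn N_gt1 prim_z) // a2 (ev0 N_gt1 prim_z).
  rewrite sqrf_eq1 (ev_eq1 N_gt1 prim_z) (negPf fa) /= => /eqP->.
  by rewrite -signr_odd odd_m expr1.
by rewrite (evMnl N_gt1 prim_z) -(evMn N_gt1 prim_z) // hm (ev0 N_gt1 prim_z).
Qed.

Section Congruence.
Variables (M : int) (e : {ffun G -> 'Z_N} -> int) (w : {ffun G -> 'Z_N}).
Hypothesis fourierE : forall f, f \in D ->
  fourier z C f = (#|C|%:Z + M * e f)%:~R /\ odd `|e f| = (f a != 0).
Hypotheses (wD : w \in D) (wa : ev w a = -1).
Hypothesis w_odd : forall h, h *+ m = 0 -> ev w h = 1.

(** The sum of [w ^ j] over the part of [C] in [h + P]; the argument [p] may stand for [h + p], as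
    [w] is trivial on [h] whenever [m h = 0]. *)
Definition coset_sum j h : algC :=
  \sum_(p in P) (h + p \in C)%:R * ev w p ^+ j.

Lemma mem_Sylow2_order2 : a \in P.
Proof. exact: (order_pow2_Sylow2 odd_m cardG (k := 1) oa). Qed.

Lemma w_neq0 : w a != 0.
Proof.
rewrite -(ev_eq1 N_gt1 prim_z) wa eq_sym -subr_eq0 opprK.
by rewrite (pnatr_eq0 algC 2).
Qed.

(** Summing the transforms at [w *+ j + f] over annihilating [f], with weights [f(- h)], isolates
    the coset [h + P]. Each transform is [|C| + M e] with [e] of the parity of [j], because [f] is
    trivial at [a]. Modulo [2 M] it is independent of [f], and the weights sum to 0 unless
    [h = 0]. *)
Lemma coset_sum_congr j h : h *+ m = 0 -> exists2 y, y \in Aint &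
  #|annihilator|%:R * coset_sum j h =
  (if h == 0 then #|annihilator|%:R * (#|C|%:Z + M * (odd j)%:Z)%:~R else 0)
   + (2 * M)%:~R * y.
Proof.
move=> hm.
have hP : (- h \in P) = (h == 0).
  rewrite inE mulNrn oppr_eq0; apply/eqP/eqP => [h2 | ->]; last by rewrite mul0rn.
  apply/eqP; rewrite -order_eq1; have := conj (order_addE h (2 ^ d)) (order_addE h m).
  rewrite h2 hm eqxx => -[d2 dm].
  by rewrite -dvdn1 -(eqP (_ : coprime (2 ^ d) m)) ?coprimeXl ?coprime2n // dvdn_gcd d2 dm.
have Ef f : f \in annihilator ->
    exists k : int, e (w *+ j + f) = (odd j)%:Z + 2 * k.
  move=> /annihilatorP[fD fP]; have [_] := fourierE (dualD (dualMn j wD) fD).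
  rewrite ffunE (fP _ mem_Sylow2_order2) addr0 => oe.
  have oj : ((w *+ j) a != 0) = odd j.
    rewrite -(ev_eq1 N_gt1 prim_z) (evMnl N_gt1 prim_z) wa -signr_odd.
    by case: odd => /=; rewrite ?eqxx // expr1 -wa (ev_eq1 N_gt1 prim_z) w_neq0.
  move: oe; rewrite oj; move: (e _) (odd j) => x [] ox.
    by exists ((x - 1) %/ 2)%Z; lia.
  by exists (x %/ 2)%Z; lia.
pose k f := ((e (w *+ j + f)%R - (odd j)%:Z) %/ 2)%Z.
have kE f : f \in annihilator -> e (w *+ j + f) = (odd j)%:Z + 2 * k f.
  by move=> /Ef[i iE]; rewrite /k iE; move: (odd j) => c; lia.
exists (\sum_(f in annihilator) (k f)%:~R * ev f (- h)).
  by apply: rpred_sum => f _; rewrite rpredM ?rpred_int // Aint_ev.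
transitivity (\sum_(f in annihilator) fourier z C (w *+ j + f) * ev f (- h)).
  rewrite /fourier; under eq_bigr do rewrite mulr_suml.
  rewrite exchange_big /=.
  transitivity (\sum_(c in C | c - h \in P) #|annihilator|%:R * ev w c ^+ j).
    rewrite /coset_sum mulr_sumr (reindex_inj (addIr (- h))) /= big_mkcond.
    rewrite [RHS]big_mkcond; apply: eq_bigr => c _.
    rewrite [h + _]addrC subrK; case: (c - h \in P) => /=; rewrite ?andbF ?andbT //.
    case: (c \in C); rewrite ?mul0r ?mulr0 // mul1r.
    by rewrite (evD N_gt1 prim_z _ _ wD) (evN N_gt1 prim_z) // (w_odd hm) invr1 mulr1.
  rewrite big_mkcondr; apply: eq_bigr => c cC.
  have -> : \sum_(f in annihilator) ev (w *+ j + f) c * ev f (- h) =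
      ev w c ^+ j * \sum_(f in annihilator) ev f (c - h).
    rewrite mulr_sumr; apply: eq_bigr => f /annihilatorP[fD _].
    by rewrite (evDl N_gt1 prim_z) (evMnl N_gt1 prim_z) (evD N_gt1 prim_z _ _ fD) mulrA.
  by rewrite sum_annihilator; case: ifP; rewrite ?mulr0 // mulrC.
transitivity (\sum_(f in annihilator) ((#|C|%:Z + M * (odd j)%:Z)%:~R * ev f (- h)
    + (2 * M)%:~R * ((k f)%:~R * ev f (- h)))).
  apply: eq_bigr => f fA; have [fD _] := annihilatorP _ fA.
  have [-> _] := fourierE (dualD (dualMn j wD) fD).
  by rewrite kE // !(intrD, intrM); ring.
rewrite big_split /= -!mulr_sumr sum_annihilator hP.
by case: eqP; rewrite ?mulr0 // mulrC.
Qed.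

Lemma coset_sum0 h : P = [set 0; a] ->
  coset_sum 0 h = (h \in C)%:R + (h + a \in C)%:R.
Proof.
move=> PE; have a0 : a != 0 by apply: contra_eq_neq oa => ->; rewrite order1.
rewrite /coset_sum PE big_setU1 ?big_set1 /= ?inE 1?eq_sym //.
by rewrite !expr0 !mulr1 addr0.
Qed.

(* Shifting the summation index by a changes the sign of the character, so the
   terms on which the indicator of C is a-periodic cancel. *)
Lemma coset_sum1 (h : G) : odd #[h]%g ->
  coset_sum 1 h = (h \in C)%:R - (h + a \in C)%:R.
Proof.
move=> oh; have a0 : a != 0 by apply: contra_eq_neq oa => ->; rewrite order1.
have aa : a + a = 0 by apply/eqP; rewrite -mulr2n -order_addE oa.
have aP := mem_Sylow2_order2.
have ev0w := ev0 N_gt1 prim_z wD.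
pose g p := ((h + p \in C)%:R - (h + (p + a) \in C)%:R) * ev w p.
have E : coset_sum 1 h + coset_sum 1 h = \sum_(p in P) g p.
  rewrite {2}/coset_sum (reindex_inj (addIr a)) /=.
  rewrite [X in _ + X](eq_bigl (mem P)) => [|p]; last first.
    by move: aP; rewrite !inE mulrnDl => /eqP->; rewrite addr0.
  rewrite -big_split; apply: eq_bigr => p _ /=.
  by rewrite !expr1 (evD N_gt1 prim_z _ _ wD) wa /g; ring.
(* Any other [p] in [P] has order at least 4, so [h + p] and [h + p + a] generate the same subgroup
   and lie in [C] together. *)
have gE : \sum_(p in P) g p = g 0 + g a.
  rewrite (bigD1 0) /=; last by rewrite inE mul0rn.
  rewrite (bigD1 a) /=; last by rewrite aP.
  rewrite big1 ?addr0 // => p /andP[/andP[pP p0] pa].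
  have [k ok] := Sylow2_order pP.
  rewrite /g (_ : (h + p \in C) = (h + (p + a) \in C)) ?subrr ?mul0r //.
  have ohp : (4 %| #[(h + p)%R]%g)%N.
    rewrite (order_oddD oh ok) dvdn_mull //.
    case: k ok => [/eqP|[|k]] ok; last by rewrite (@dvdn_exp2l 2 2).
      by move: ok; rewrite order_eq1 (negPf p0).
    by move: pa; rewrite (order2_unique odd_m cardG cyclic_Sylow2 ok oa) eqxx.
  have := cycle_addr_order2 odd_m cardG cyclic_Sylow2 oa ohp.
  rewrite -addrA => cE; apply/idP/idP; first exact: stC.
  by apply: stC.
have : coset_sum 1 h *+ 2 = ((h \in C)%:R - (h + a \in C)%:R) *+ 2.
  rewrite mulr2n E gE /g add0r aa addr0 ev0w wa; ring.
by move/eqP; rewrite eqrMn2r => /eqP.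
Qed.

(** A shift by [b] also changes the sign, as [w(b) ^ 2 = w(a) = -1]. For [p] in [P] other than 0,
    [a], [b], [- b] the order of [h + p] is divisible by 8, so [h + p] and [h + p + b] are
    power-equivalent and cancel. *)
Lemma coset_sum2 (h b : G) : odd #[h]%g -> #[b]%g = 4%N ->
  coset_sum 2 h = (h \in C)%:R + (h + a \in C)%:R
                  - (h + b \in C)%:R - (h - b \in C)%:R.
Proof.
move=> oh ob.
have aa : a + a = 0 by apply/eqP; rewrite -mulr2n -order_addE oa.
have a0 : a != 0 by apply: contra_eq_neq oa => ->; rewrite order1.
have bb : b + b = a.
  apply: (order2_unique odd_m cardG cyclic_Sylow2) => //.
  by rewrite -[b + b]/(b ^+ 2)%g orderXdiv ob.
have b0 : b != 0 by apply: contraNneq a0 => b0; rewrite -bb b0 addr0.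
have ba : b != a by apply: contraNneq a0 => ba; rewrite -bb ba aa.
have bNa : - b = a + b by apply/eqP; rewrite eq_sym -addr_eq0 -addrA bb aa.
have Nb0 : - b != 0 by rewrite oppr_eq0.
have Nba : - b != a.
  by apply: contraNneq b0 => E; apply/eqP/(addrI a); rewrite -bNa E addr0.
have Nbb : - b != b.
  by apply: contraNneq a0 => bN; rewrite -bb -{1}bN addNr.
have aP := mem_Sylow2_order2.
have bP : b \in P := order_pow2_Sylow2 odd_m cardG (k := 2) ob.
have NbP : - b \in P by move: bP; rewrite !inE mulNrn oppr_eq0.
have ev0w := ev0 N_gt1 prim_z wD.
have wb : ev w b ^+ 2 = -1 by rewrite -(evMn N_gt1 prim_z) // mulr2n bb.
have wNb : ev w (- b) ^+ 2 = -1.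
  by rewrite (evN N_gt1 prim_z) // exprVn wb invrN1.
pose g p := ((h + p \in C)%:R - (h + (p + b) \in C)%:R) * ev w p ^+ 2.
have E : coset_sum 2 h + coset_sum 2 h = \sum_(p in P) g p.
  rewrite {2}/coset_sum (reindex_inj (addIr b)) /=.
  rewrite [X in _ + X](eq_bigl (mem P)) => [|p]; last first.
    by move: bP; rewrite !inE mulrnDl => /eqP->; rewrite addr0.
  rewrite -big_split; apply: eq_bigr => p _ /=.
  by rewrite (evD N_gt1 prim_z _ _ wD) exprMn wb /g; ring.
have gE : \sum_(p in P) g p = g 0 + (g a + (g b + g (- b))).
  rewrite (bigD1 0) /=; last by rewrite inE mul0rn.
  rewrite (bigD1 a) /=; last by rewrite aP.
  rewrite (bigD1 b) /=; last by rewrite bP b0.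
  rewrite (bigD1 (- b)) /=; last by rewrite NbP Nb0 Nba.
  rewrite big1 ?addr0 // => p /andP[/andP[/andP[/andP[pP p0] pa] pb] pNb].
  have [k ok] := Sylow2_order pP.
  rewrite /g (_ : (h + p \in C) = (h + (p + b) \in C)) ?subrr ?mul0r //.
  have ohp : (8 %| #[(h + p)%R]%g)%N.
    rewrite (order_oddD oh ok) dvdn_mull //.
    case: k ok => [/eqP|[|[|k]]] ok; last by rewrite (@dvdn_exp2l 2 3).
    - by move: ok; rewrite order_eq1 (negPf p0).
    - by move: pa; rewrite (order2_unique odd_m cardG cyclic_Sylow2 ok oa) eqxx.
    have [pE|pE] := order4_unique odd_m cardG cyclic_Sylow2 ob ok.
      by rewrite pE eqxx in pb.
    by rewrite pE eqxx in pNb.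
  have := cycle_addr_order4 odd_m cardG cyclic_Sylow2 ob ohp.
  rewrite -addrA => cE; apply/idP/idP; first exact: stC.
  by apply: stC.
have : coset_sum 2 h *+ 2 = ((h \in C)%:R + (h + a \in C)%:R
                  - (h + b \in C)%:R - (h - b \in C)%:R) *+ 2.
  rewrite mulr2n E gE /g add0r bb addNr -bNa addr0 ev0w wa wb wNb; ring.
by move/eqP; rewrite eqrMn2r => /eqP.
Qed.

End Congruence.
End PartialInversion.

(** The working form of (c) and (d). The element 0 is left out: it is not in [C], whereas [a] or [b]
    may be. *)
Definition odd_translation_invariant (G : finZmodType) (C : {set G}) (a : G) :=
  forall h : G, odd #[h]%g -> h != 0 -> (h \in C) = (h + a \in C).

(** * Arithmetic consequences of the coset congruences *)

Section ForwardConditions.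
Variables (R : realType) (G : finZmodType) (d m : nat) (C : {set G}) (a : G).
Hypotheses (odd_m : odd m) (cardG : #|G| = (2 ^ d * m)%N).
Hypothesis cyclic_Sylow2 :
  forall P : {group G}, (2.-Sylow([set: G]) P)%g -> cyclic P.
Hypothesis C_sym : forall g, g \in C -> - g \in C.
Hypothesis C_irrefl : 0 \notin C.
Hypothesis oa : #[a]%g = 2%N.

Implicit Types (g h q b : G).

Lemma odd_order_mulm h : odd #[h]%g -> h *+ m = 0.
Proof.
move=> oh; apply/eqP; rewrite -order_addE.
rewrite -(@Gauss_dvdr _ (2 ^ d)) ?(order_dvd_card cardG) //.
by rewrite coprimeXr // coprimen2.
Qed.

(** The coset congruences over the integers, for [j = 1], [j = 2] and, when [d = 1], [j = 0]. The
    odd [A] counts the annihilating characters; at [h = 0] the term [|C|] and, for odd [j], the term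
    [M] remain. *)
Lemma pst_coset_congruences : perfect_state_transfer R (cayley_graph C) ->
  power_stable C /\ exists A M : int, [/\ odd `|A|, M != 0,
    forall h, odd #[h]%g -> h != 0 ->
      (2 * M %| A * ((h \in C)%:Z - (h + a \in C)%:Z))%Z &
    [/\ (2 * M %| A * (- (a \in C)%:Z - #|C|%:Z - M))%Z,
        forall b, #[b]%g = 4%N ->
        (forall h, odd #[h]%g -> h != 0 ->
         (2 * M %| A * ((h \in C)%:Z + (h + a \in C)%:Z
                       - (h + b \in C)%:Z - (h - b \in C)%:Z))%Z) /\
        (2 * M %| A * ((a \in C)%:Z - 2 * (b \in C)%:Z - #|C|%:Z))%Z
      & d = 1%N ->
        (forall h, odd #[h]%g -> h != 0 ->
         (2 * M %| A * ((h \in C)%:Z + (h + a \in C)%:Z))%Z) /\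
        (2 * M %| A * ((a \in C)%:Z - #|C|%:Z))%Z]].
Proof.
have [N [z [N_gt1 dvdGN prim_z]]] := exists_splitting_root G.
case/(pst_congruence N_gt1 dvdGN prim_z C_sym C_irrefl) => a' [M [e [a0 aa M0 eE]]].
have aE : a' = a.
  apply: (order2_unique odd_m cardG cyclic_Sylow2) => //.
  by apply: nt_prime_order => //; rewrite -[LHS]/(a' *+ 2) mulr2n.
rewrite {a0 aa}aE in eE.
have stC : power_stable C.
  apply: (rational_power_stable N_gt1 dvdGN prim_z) => f fD.
  by have [-> _] := eE f fD; rewrite rpred_int.
split=> //.
have [w [wD wa w_odd]] := odd_trivial_character odd_m N_gt1 dvdGN prim_z oa.
pose A := #|annihilator G d N|%:Z.
have dvd0 j h t : odd #[h]%g -> h != 0 ->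
    coset_sum d C z w j h = t%:~R -> (2 * M %| A * t)%Z.
  move=> oh h0 tE.
  have [y yA] := coset_sum_congr odd_m cardG N_gt1 dvdGN prim_z
    oa eE wD wa w_odd j (odd_order_mulm oh).
  rewrite (negPf h0) add0r tE => E; apply: (Aint_dvdz _ yA); first lia.
  by rewrite -E intrM.
have dvd1 j t : coset_sum d C z w j 0 = t%:~R ->
    (2 * M %| A * (t - #|C|%:Z - M * (odd j)%:Z))%Z.
  move=> tE.
  have [y yA] := coset_sum_congr odd_m cardG N_gt1 dvdGN prim_z
    oa eE wD wa w_odd j (mul0rn _ m).
  rewrite eqxx tE => E; apply: (Aint_dvdz _ yA); first lia.
  by rewrite -[RHS](addrK (#|annihilator G d N|%:R * (#|C|%:Z + M * (odd j)%:Z)%:~R))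
    [_ + _ * _]addrC -E !(intrM, intrD, intrB); ring.
have o0 : odd #[0 : G]%g by rewrite order1.
have cs1 := coset_sum1 odd_m cardG cyclic_Sylow2 N_gt1 prim_z oa stC wD wa.
have cs2 := coset_sum2 odd_m cardG cyclic_Sylow2 N_gt1 prim_z oa stC wD wa.
exists A, M; split=> //.
- exact: (odd_annihilator odd_m cardG N_gt1 dvdGN prim_z).
- by move=> h oh h0; apply: (dvd0 1%N h) => //; rewrite cs1 // intrB.
split.
- have := dvd1 1%N (- (a \in C)%:Z); rewrite mulr1; apply.
  by rewrite cs1 // (negPf C_irrefl) !add0r intrN.
- move=> b ob; split=> [h oh h0|].
    by apply: (dvd0 2%N h) => //; rewrite (cs2 h b) // !(intrB, intrD).
  have := dvd1 2%N ((a \in C)%:Z - 2 * (b \in C)%:Z); rewrite mulr0 subr0; apply.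
  rewrite (cs2 0 b) // (negPf C_irrefl) !add0r intrB intrM.
  have -> : (- b \in C) = (b \in C) by apply/idP/idP => /C_sym; rewrite ?opprK.
  by rewrite -[RHS]/(_ - 2%:R * _); ring.
move=> d1.
have PE : Sylow2 G d = [set 0; a].
  apply/eqP; rewrite eq_sym eqEcard (card_Sylow2 odd_m cardG) d1 cards2.
  rewrite eq_sym; have -> : a != 0 by apply: contra_eq_neq oa => ->; rewrite order1.
  rewrite andbT; apply/fintype.subsetP => x; rewrite !inE => /orP[] /eqP ->.
    by rewrite mul0rn.
  by rewrite -order_addE oa.
have cs0 h := coset_sum0 C z oa w h PE.
split=> [h oh h0|]; first by apply: (dvd0 0%N h) => //; rewrite cs0 intrD.
have := dvd1 0%N (a \in C)%:Z; rewrite mulr0 subr0; apply.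
by rewrite cs0 (negPf C_irrefl) !add0r.
Qed.

Lemma odd_dvdz (k : nat) (A M t : int) : odd `|A| -> ((2 ^ k)%N%:Z %| M)%Z ->
  (M %| A * t)%Z -> ((2 ^ k)%N%:Z %| t)%Z.
Proof.
move=> oA kM /(dvdz_trans kM); rewrite Gauss_dvdzr // coprimezE /=.
by rewrite coprimeXl // coprime2n.
Qed.

Lemma dvdz2_addl (t M : int) : ((2 ^ 1)%N%:Z %| 2 * t + M)%Z -> (2 %| M)%Z.
Proof.
move=> H; rewrite -[M](addKr (2 * t)) rpredD // rpredN.
exact: (dvdz_mulr _ (dvdzz 2)).
Qed.

Lemma pst_forward1 : d = 1%N -> perfect_state_transfer R (cayley_graph C) ->
  C = [set a].
Proof.
move=> d1 /pst_coset_congruences[stC [A [M [oA M0 H1 [H2 _ H4]]]]].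
have [{}H4 H5] := H4 d1.
have d2M : ((2 ^ 1)%N%:Z %| 2 * M)%Z by rewrite dvdz_mulr.
(* Subtracting the congruences for [j = 0] and [j = 1] at [h = 0] eliminates [|C|]. *)
have E : (2 * M %| A * (2 * (a \in C)%:Z + M))%Z.
  rewrite (_ : _ * _ = A * ((a \in C)%:Z - #|C|%:Z) -
    A * (- (a \in C)%:Z - #|C|%:Z - M)); first exact: rpredB.
  by ring.
(* With [a] outside [C], [2 M] would divide [A M], against [A] odd; reduction modulo 2 makes [M]
   even. *)
have [aC evM] : a \in C /\ (2 %| M)%Z.
  have E2 := odd_dvdz oA d2M E; case: (a \in C) E E2 => E E2.
    by split=> //; apply: dvdz2_addl E2.
  move: E; rewrite mulr0 add0r dvdz_mul2r //; lia.
have d4M : ((2 ^ 2)%N%:Z %| 2 * M)%Z by rewrite (@dvdz_mul 2 2).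
(* The two indicators have a sum at most 2 and divisible by 4, hence 0. *)
have C_odd h : odd #[h]%g -> h != 0 -> (h \in C) = false /\ (h + a \in C) = false.
  move=> oh h0; have := odd_dvdz oA d2M (H1 h oh h0).
  have := odd_dvdz oA d4M (H4 h oh h0).
  by case: (h \in C); case: (h + a \in C).
have aa : a + a = 0 by apply/eqP; rewrite -mulr2n -order_addE oa.
apply/setP => g; rewrite inE; apply/idP/eqP => [gC | -> //].
have [h [q [k [gE oh oq _]]]] := odd_pow2_decomposition g.
have q2 : q *+ 2 = 0.
  by have := order_pow2_Sylow2 odd_m cardG oq; rewrite inE d1 => /eqP.
have [q0|q0] := eqVneq q 0.
  have h0 : h != 0 by apply: contraNneq C_irrefl => <-; rewrite -[h]addr0 -q0 -gE.
  by have [hC _] := C_odd h oh h0; rewrite gE q0 addr0 hC in gC.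
have qa : q = a.
  by apply: (order2_unique odd_m cardG cyclic_Sylow2) => //; apply: nt_prime_order.
have [h0|h0] := eqVneq h 0; first by rewrite gE h0 qa add0r.
by have [_ hC] := C_odd h oh h0; rewrite gE qa hC in gC.
Qed.

Lemma pst_forward2 b : #[b]%g = 4%N ->
  perfect_state_transfer R (cayley_graph C) ->
  [/\ power_stable C, (a \in C) != (b \in C),
      odd_translation_invariant C a & odd_translation_invariant C b].
Proof.
move=> ob /pst_coset_congruences[stC [A [M [oA M0 H1 [H2 H3 _]]]]].
have [{}H3 H4] := H3 b ob.
have d2M : ((2 ^ 1)%N%:Z %| 2 * M)%Z by rewrite dvdz_mulr.
(* Again [|C|] is eliminated, now between [j = 2] and [j = 1]; equal indicators of [a] and [b] would
   let [2 M] divide [A M]. *)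
have E : (2 * M %| A * (2 * (a \in C)%:Z - 2 * (b \in C)%:Z + M))%Z.
  rewrite (_ : _ * _ = A * ((a \in C)%:Z - 2 * (b \in C)%:Z - #|C|%:Z) -
    A * (- (a \in C)%:Z - #|C|%:Z - M)); first exact: rpredB.
  by ring.
have [ab evM] : (a \in C) != (b \in C) /\ (2 %| M)%Z.
  have E2 := odd_dvdz oA d2M E.
  have [ab|] := eqVneq (a \in C) (b \in C); last first.
    by rewrite -mulrBr in E2; split=> //; apply: dvdz2_addl E2.
  move: E; rewrite ab subrr add0r dvdz_mul2r //; lia.
have d4M : ((2 ^ 2)%N%:Z %| 2 * M)%Z by rewrite (@dvdz_mul 2 2).
have inv_a : odd_translation_invariant C a.
  move=> h oh h0; have := odd_dvdz oA d2M (H1 h oh h0).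
  by case: (h \in C); case: (h + a \in C).
split=> // h oh h0.
(* Modulo 4, twice the indicator of [h] is the sum of those of [h + b] and [h - b], which forces all
   three to agree. *)
have := odd_dvdz oA d4M (H3 h oh h0); rewrite -inv_a //.
by case: (h \in C); case: (h + b \in C); case: (h - b \in C).
Qed.

End ForwardConditions.

(** * Conditions (c) and (d) as translation invariance *)

Section OrderParts.
Variables (G : finZmodType) (d m : nat) (C : {set G}) (a b : G).
Hypotheses (odd_m : odd m) (cardG : #|G| = (2 ^ d * m)%N).
Hypothesis cyclic_Sylow2 :
  forall P : {group G}, (2.-Sylow([set: G]) P)%g -> cyclic P.
Hypothesis C_irrefl : 0 \notin C.
Hypotheses (oa : #[a]%g = 2%N) (ob : #[b]%g = 4%N).
Hypothesis stC : power_stable C.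
Implicit Types (g h q x : G).

Lemma order_partP k x : reflect (exists h q,
    [/\ x \in C, x = h + q, odd #[h]%g & #[q]%g = (2 ^ k)%N])
  (x \in order_part C k).
Proof.
rewrite inE; apply: (iffP andP) => [[xC /asboolP[m' om' ox]]|[h [q [xC xE oh oq]]]].
  have [h [q [k' [xE oh oq ox']]]] := odd_pow2_decomposition x.
  exists h, q; split=> //; rewrite oq; congr (2 ^ _)%N.
  have lognE o j : odd o -> logn 2 (o * 2 ^ j) = j.
    by move=> oo; rewrite lognM ?expn_gt0 // ?odd_gt0 // pfactorK // logn_coprime ?coprime2n.
  by rewrite -(lognE #[h]%g k') // -ox' ox mulnC lognE.
by split=> //; apply/asboolP; exists #[h]%g; rewrite // xE (order_oddD oh oq) mulnC.
Qed.

Lemma signed_order4P q : #[q]%g = 4%N <-> q = b \/ q = - b.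
Proof.
split=> [oq | [-> //| ->]]; last by rewrite -[- b]/(b^-1)%g orderV.
exact: (order4_unique odd_m cardG cyclic_Sylow2).
Qed.

Lemma order4_mul q : #[q]%g = 4%N -> q *+ 2 = a /\ q *+ 4 = 0.
Proof.
move=> oq; split; last by rewrite -[LHS]/(q ^+ 4)%g -oq expg_order.
apply: (order2_unique odd_m cardG cyclic_Sylow2) => //.
by rewrite -[q *+ 2]/(q ^+ 2)%g orderXdiv oq.
Qed.

Local Notation S := (order_part C 2 :\: [set - b; b]).

(** Removing [b] and [- b] removes exactly the elements whose odd part [h] is 0. *)
Lemma mem_S x : reflect (exists h q,
    [/\ h + q \in C, odd #[h]%g, h != 0, #[q]%g = 4%N & x = h + q]) (x \in S).
Proof.
rewrite finset.in_setD; apply: (iffP andP) => [[xb /order_partP[h [q [xC xE oh oq]]]] |].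
  exists h, q; rewrite -xE; split=> //; apply: contraNneq xb => h0.
  rewrite xE h0 add0r !inE.
  by have [-> | ->] := (signed_order4P q).1 oq; rewrite eqxx ?orbT.
case=> h [q [xC oh h0 oq ->]]; split; last by apply/order_partP; exists h, q.
have := order_oddD oh (oq : _ = (2 ^ 2)%N).
rewrite !inE; apply: contra_eqN => H.
have -> : #[h + q]%g = 4%N.
  by apply/signed_order4P; case/orP: H => /eqP ->; [right | left].
rewrite (@eqn_pmul2r 4 1) // eq_sym; apply: contraNN h0.
by rewrite order_eq1.
Qed.

(** Odd part and 2-part vary independently within their power classes, and all elements of order 4
    are power-equivalent. *)
Lemma stable_oddD h h' q q' : odd #[h]%g -> #[q]%g = 4%N -> #[q']%g = 4%N ->
  <[h]>%g = <[h']>%g -> h + q \in C -> h' + q' \in C.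
Proof.
move=> oh oq oq' hh; apply: stC; apply: (cycle_oddD oh (oq : _ = (2 ^ 2)%N) hh).
exact: (cycle_eq_order_pow2 odd_m cardG cyclic_Sylow2 (k := 2)).
Qed.

Lemma order_cycle h h' : <[h]>%g = <[h']>%g -> #[h]%g = #[h']%g.
Proof. by rewrite /order => ->. Qed.

Lemma cycle_neq0 h h' : <[h]>%g = <[h']>%g -> h != 0 -> h' != 0.
Proof. by move=> hh; rewrite -!order_eq1 (order_cycle hh). Qed.

(** For [q] of order 4, multiplication by 4 sends [h + q] to [4 h] and multiplication by 2 sends it
    to [2 h + a], while [h], [2 h] and [4 h] generate the same subgroup. So (c) links [h] with
    [h + b], and (d) links [h + a] with [h + b]. *)
Lemma order_parts_translation :
  odd_translation_invariant C a /\ odd_translation_invariant C b <->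
  order_part C 0 = mulset 4 S /\ order_part C 1 :\ a = mulset 2 S.
Proof.
have oN1 (q : G) : #[q]%g = (2 ^ 0)%N -> q = 0 by move/eqP; rewrite order_eq1 => /eqP.
split=> [[inv_a inv_b] | [E0 E1]].
  have mem_hC h q : odd #[h]%g -> h != 0 -> #[q]%g = 4%N -> h + q \in C -> h \in C.
    by move=> oh h0 oq hC; rewrite inv_b //; apply: (stable_oddD oh oq) hC.
  (* Preimages under multiplication by [2 ^ k] come from dividing [h] inside its power class. *)
  have half_mem h k : odd #[h]%g -> h != 0 -> h \in C -> exists h',
      [/\ h' + b \in S, h = h' *+ 2 ^ k & odd #[h']%g].
    move=> oh h0 hC; have [h' hh hE] := odd_order_halve k oh.
    have oh' : odd #[h']%g by rewrite (order_cycle hh).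
    have h'0 : h' != 0 by apply: cycle_neq0 (esym hh) h0.
    exists h'; split=> //; apply/mem_S; exists h', b; split=> //.
    by rewrite -inv_b //; apply: stC (esym hh) hC.
  split; apply/setP => g; apply/idP/imsetP.
  - move=> /order_partP[h [q [gC gE oh /oN1 q0]]]; rewrite {}q0 addr0 in gE.
    rewrite gE in gC *; have h0 : h != 0 by apply: contraNneq C_irrefl => <-.
    have [h' [h'S hE _]] := half_mem h 2 oh h0 gC.
    by exists (h' + b) => //; rewrite mulrnDl (order4_mul ob).2 addr0.
  - case=> _ /mem_S[h [q [xC oh h0 oq ->]]] ->.
    have hh := odd_order_double 2 oh.
    rewrite mulrnDl (order4_mul oq).2 addr0; apply/order_partP.
    exists (h *+ 4), 0; rewrite addr0 order1 -(order_cycle hh); split=> //.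
    by apply: stC hh _; apply: mem_hC xC.
  - rewrite finset.in_setD1 => /andP[ga /order_partP[h [q [gC gE oh oq]]]].
    have qa : q = a by apply: (order2_unique odd_m cardG cyclic_Sylow2).
    rewrite {}gE {}qa in ga gC *.
    have h0 : h != 0 by apply: contraNneq ga => ->; rewrite add0r.
    have hC : h \in C by rewrite inv_a.
    have [h' [h'S hE _]] := half_mem h 1 oh h0 hC.
    by exists (h' + b) => //; rewrite mulrnDl (order4_mul ob).1 {1}hE.
  - case=> _ /mem_S[h [q [xC oh h0 oq ->]]] ->.
    have hh := odd_order_double 1 oh; have h20 := cycle_neq0 hh h0.
    have oh2 : odd #[h *+ 2]%g by rewrite -(order_cycle hh).
    rewrite mulrnDl (order4_mul oq).1 finset.in_setD1 -subr_eq0 addrK h20 /=.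
    apply/order_partP; exists (h *+ 2), a; split=> //.
    by rewrite -inv_a //; apply: stC hh _; apply: mem_hC xC.
have inv_b : odd_translation_invariant C b.
  move=> h oh h0; apply/idP/idP => hC.
    have : h \in order_part C 0.
      by apply/order_partP; exists h, 0; rewrite addr0 order1.
    rewrite E0 => /imsetP[_ /mem_S[h' [q [xC oh' h'0 oq ->]]]].
    rewrite mulrnDl (order4_mul oq).2 addr0 => hE.
    by apply: stable_oddD xC => //; rewrite hE; apply: (odd_order_double 2).
  have : (h + b) *+ 4 \in order_part C 0.
    by rewrite E0; apply/imsetP; exists (h + b) => //; apply/mem_S; exists h, b.
  rewrite mulrnDl (order4_mul ob).2 addr0 => /order_partP[_ [_ [h4C _ _ _]]].
  exact: stC (esym (odd_order_double 2 oh)) h4C.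
split=> // h oh h0.
have o2a : #[a]%g = (2 ^ 1)%N by [].
apply/idP/idP => hC.
  have : (h + b) *+ 2 \in order_part C 1 :\ a.
    rewrite E1; apply/imsetP; exists (h + b) => //; apply/mem_S; exists h, b.
    by rewrite -inv_b.
  rewrite mulrnDl (order4_mul ob).1 finset.in_setD1 => /andP[_ /order_partP[_ [_ [h2C _ _ _]]]].
  have hh := odd_order_double 1 oh.
  have oh2 : odd #[h *+ 2]%g by rewrite -(order_cycle hh).
  exact: stC (cycle_oddD oh2 o2a (esym hh) erefl) h2C.
have : h + a \in order_part C 1 :\ a.
  rewrite finset.in_setD1 -subr_eq0 addrK h0; apply/order_partP.
  by exists h, a.
rewrite E1 => /imsetP[_ /mem_S[h' [q [xC oh' h'0 oq ->]]]].
rewrite mulrnDl (order4_mul oq).1 => /addIr hE.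
rewrite inv_b //; apply: stable_oddD xC => //; rewrite hE.
exact: (odd_order_double 1).
Qed.

End OrderParts.

(** * Sufficiency *)

Section IntegralSums.
Variables (N : nat) (G : finZmodType) (z : algC).
Hypotheses (N_gt1 : (1 < N)%N) (prim_z : N.-primitive_root z).
Implicit Types (C E : {set G}) (f : {ffun G -> 'Z_N}) (g h x : G).
Local Notation D := (dual N G).
Local Notation ev := (character_value z).

Lemma fourier_int_of_classes E f : power_stable E ->
  (forall g, g \in E -> \sum_(x | <[x]>%g == <[g]>%g) ev f x \in Num.int) ->
  fourier z E f \in Num.int.
Proof.
move=> stE H; rewrite /fourier (partition_big (fun x => <[x]>%g : {set G}) xpredT) //=.
apply: rpred_sum => Z _.
have [/existsP[g /andP[gE /eqP gZ]] | H0] := boolP [exists g, (g \in E) && (<[g]>%g == Z)].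
  rewrite (eq_bigl (fun x => <[x]>%g == <[g]>%g)) ?H // => x /=.
  rewrite -gZ; case: eqP; rewrite ?andbF // => /esym xg.
  by rewrite (stE g x).
rewrite big_pred0 ?rpred0 // => x; apply: contraNF H0 => xZ.
by apply/existsP; exists x.
Qed.

Lemma cycle_sum_int g f : f \in D -> \sum_(x in <[g]>%g) ev f x \in Num.int.
Proof.
move=> fD; have [/forall_inP H | ] := boolP [forall x in <[g]>%g, ev f x == 1].
  rewrite (eq_bigr (fun=> 1)) => [|x /H/eqP //].
  by rewrite sumr_const rpredMn ?rpred1.
rewrite negb_forall_in => /exists_inP[y yg fy].
rewrite (@sum_twisted_eq0 _ _ _ (ev f) (fun x => x + y) (ev f y) (addIr y)) ?rpred0 // => x.
  exact: groupMr.
by move=> _; rewrite (evD N_gt1 prim_z).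
Qed.

(** Induction on the order of [g]: the class is the cycle, whose sum is its order or 0, minus the
    elements generating smaller cycles, which form a power-stable set. *)
Lemma class_sum_int g f : f \in D ->
  \sum_(x | <[x]>%g == <[g]>%g) ev f x \in Num.int.
Proof.
move=> fD; have [n] := ubnP #[g]%g; elim: n g => // n IH g gn.
pose E := [set x in <[g]>%g | <[x]>%g != <[g]>%g].
have EE : \sum_(x | <[x]>%g == <[g]>%g) ev f x =
    \sum_(x in <[g]>%g) ev f x - fourier z E f.
  apply/eqP; rewrite eq_sym subr_eq (bigID (fun x => <[x]>%g == <[g]>%g)) /=.
  apply/eqP; congr (_ + _).
    apply: eq_bigl => x; case: eqP => [<-|]; by rewrite ?andbF ?cycle_id.
  by apply: eq_bigl => x; rewrite !inE.
rewrite EE rpredB ?cycle_sum_int //; apply: fourier_int_of_classes => [x y xy|x].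
  by rewrite !finset.in_set xy -!cycle_subG xy.
rewrite finset.in_set => /andP[xg xNg]; apply: IH.
rewrite ltnS in gn; apply: leq_trans gn.
by rewrite /order proper_card // finset.properEneq xNg cycle_subG.
Qed.

Lemma fourier_int C f : power_stable C -> f \in D -> fourier z C f \in Num.int.
Proof.
move=> stC fD; apply: fourier_int_of_classes => // g _.
exact: class_sum_int.
Qed.

(** [C] is a union of cosets of the cycle of [b]. If [f] is nontrivial at [b] the sum vanishes;
    otherwise each coset contributes the order of [b] times one root of unity. *)
Lemma fourier_periodic C b f : f \in D -> (forall x, x \in C -> x + b \in C) ->
  exists2 y, y \in Aint & fourier z C f = #[b]%g%:R * y.
Proof.
move=> fD Cb.
have CbE x : (x + b \in C) = (x \in C).
  apply/idP/idP => [xb|]; last exact: Cb.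
  have Cn n u : u \in C -> u + b *+ n \in C.
    elim: n u => [|n IH] u uC; first by rewrite mulr0n addr0.
    by rewrite mulrS addrA IH ?Cb.
  have := Cn #[b]%g.-1 _ xb; rewrite -addrA -mulrS prednK ?order_gt0 //.
  by rewrite -[b *+ _]/(b ^+ _)%g expg_order addr0.
have [fb | fb] := eqVneq (ev f b) 1; last first.
  exists 0; rewrite ?rpred0 // mulr0.
  apply: (@sum_twisted_eq0 _ _ _ (ev f) (fun x => x + b) _ (addIr b) CbE _ fb).
  by move=> x _; rewrite (evD N_gt1 prim_z).
have coset x y : x \in (<[b]> :* y)%g -> exists i, x = y + b *+ i.
  case/rcosetP=> _ /cycleP[i ->] ->; exists i; exact: addrC.
have Cn x i : (x + b *+ i \in C) = (x \in C).
  elim: i => [|i IH]; first by rewrite mulr0n addr0.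
  by rewrite mulrSr addrA CbE.
have fn x i : ev f (x + b *+ i) = ev f x.
  by rewrite (evD N_gt1 prim_z) // (evMn N_gt1 prim_z) // fb expr1n mulr1.
(* The value of [f] at a representative in [C] of the coset [Z], and 0 if there is none. *)
pose y (Z : {set G}) := if [pick x in C | (<[b]> :* x)%g == Z] is Some x then ev f x else 0.
exists (\sum_Z y Z).
  apply: rpred_sum => Z _; rewrite /y; case: pickP => [x _|_]; last exact: rpred0.
  exact: Aint_ev.
rewrite /fourier (partition_big (fun x => (<[b]> :* x)%g : {set G}) xpredT) //=.
rewrite mulr_sumr; apply: eq_bigr => Z _; rewrite /y.
case: pickP => [x /andP[xC /eqP xZ] | H0]; last by rewrite big_pred0 ?mulr0.
rewrite mulr_natl -[#[b]%g](card_rcoset <[b]>%g x) -sumr_const.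
rewrite (eq_bigl (fun u => u \in (<[b]> :* x)%g)) => [|u].
  by apply: eq_bigr => u /coset[i ->].
rewrite -xZ; apply/andP/idP => [[_ /eqP ux] | ux].
  by apply/rcoset_eqP.
by split; [have [i ->] := coset _ _ ux; rewrite Cn | apply/eqP/rcoset_eqP].
Qed.

End IntegralSums.

(** * Perfect state transfer at time pi / 2 *)

Section Sufficiency.
Variables (R : realType) (N : nat) (G : finZmodType) (C : {set G}) (zA : algC) (a : G).
Hypotheses (N_gt1 : (1 < N)%N) (dvdGN : (#|G| %| N)%N).
Hypothesis prim_zA : N.-primitive_root zA.
Hypothesis C_sym : forall g, g \in C -> - g \in C.
Hypothesis oa : #[a]%g = 2%N.

Lemma expi_half_turns (k r : int) :
  expi (pi / 2 * (4 * k + r)%:~R) = expi (pi / 2 * r%:~R) :> R[i].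
Proof.
rewrite intrD mulrDr expiD -[RHS]mul1r; congr (_ * _).
have -> : pi / 2 * (4 * k)%:~R = pi *~ (2 * k) :> R.
  by rewrite -mulrzl !intrM; field.
by rewrite expi_piMint; apply/eqP; rewrite sign_exprz abszM oddM.
Qed.

(** At time [pi / 2] only eigenvalues modulo 4 matter, and the difference 2 between characters
    trivial and nontrivial at [a] produces the required phase -1. *)
Lemma pst_of_residues (r : int) :
  (forall f : {ffun G -> 'Z_N}, f \in dual N G -> exists k : int,
     fourier zA C f = (4 * k + (if f a == 0 then r + 2 else r))%:~R) ->
  perfect_state_transfer R (cayley_graph C).
Proof.
move=> H; have [z [prim_z ratE]] := conjugate_root_of_unity R[i] prim_zA.
have a0 : a != 0 by apply: contra_eq_neq oa => ->; rewrite order1.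
have FE f : f \in dual N G -> expi (pi / 2 * complex.Re (fourier z C f)) =
    expi (pi / 2 * (if f a == 0 then r + 2 else r)%:~R) :> R[i].
  move=> fD; have [k kE] := H f fD; rewrite -(expi_half_turns k).
  have /eqP -> : fourier z C f == ratr (4 * k + (if f a == 0 then r + 2 else r))%:~R.
    by rewrite ratE kE rmorph_int.
  by rewrite ratr_int -(rmorph_int (real_complex R)).
apply/(pst_spectral N_gt1 dvdGN C_sym prim_z); exists (pi / 2), a; split=> // f fD.
rewrite !FE ?dual0 // ffunE eqxx.
have a2 : a *+ 2 = 0 by apply/eqP; rewrite -order_addE oa.
have : character_value z f a ^+ 2 == 1.
  by rewrite -(evMn N_gt1 prim_z) // a2 (ev0 N_gt1 prim_z).
rewrite sqrf_eq1 (ev_eq1 N_gt1 prim_z); case: eqP => [fa0 _|_ /= /eqP ->].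
  by rewrite /character_value fa0 expr0 mul1r.
rewrite intrD mulrDr expiD (_ : pi / 2 * 2%:~R = pi :> R) ?expi_pi ?mulN1r ?mulrN1 //.
by rewrite -[2%:~R]/(2%:R); field.
Qed.

End Sufficiency.

(** * Sufficiency of the conditions in the presence of elements of order four *)

Section Backward.
Variables (R : realType) (G : finZmodType) (d m : nat) (C : {set G}) (a b : G).
Hypotheses (odd_m : odd m) (cardG : #|G| = (2 ^ d * m)%N).
Hypothesis cyclic_Sylow2 :
  forall P : {group G}, (2.-Sylow([set: G]) P)%g -> cyclic P.
Hypothesis C_sym : forall g, g \in C -> - g \in C.
Hypothesis C_irrefl : 0 \notin C.
Hypotheses (oa : #[a]%g = 2%N) (ob : #[b]%g = 4%N).
Hypothesis stC : power_stable C.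
Hypotheses (inv_a : odd_translation_invariant C a)
  (inv_b : odd_translation_invariant C b).
Implicit Types (g h q x : G).

(** [C] without [a], [b] and [- b]; describing these by their orders makes power-stability
    immediate. *)
Let S := [set x in C | (#[x]%g != 2%N) && (#[x]%g != 4%N)].

Let mem_S x : (x \in S) = [&& x \in C, #[x]%g != 2%N & #[x]%g != 4%N].
Proof. exact: finset.in_set. Qed.

Lemma mem_opp_b : (- b \in C) = (b \in C).
Proof. by apply/idP/idP => /C_sym; rewrite ?opprK. Qed.

Lemma doubleb : b + b = a.
Proof.
by rewrite -mulr2n (order4_mul odd_m cardG cyclic_Sylow2 oa ob).1.
Qed.

Lemma oppb : - b = a + b.
Proof.
apply/eqP; rewrite eq_sym -addr_eq0 -addrA doubleb -mulr2n -order_addE.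
by rewrite oa.
Qed.

Lemma small_part_stable : power_stable S.
Proof.
move=> g h gh; rewrite !mem_S (order_cycle gh) => /andP[gC ->].
by rewrite andbT; apply: stC gC.
Qed.

(** If the 2-part of [x] has order at least 8, [x] and [x + b] are power-equivalent. Otherwise the
    odd part [h] is nonzero, and [h], [h + a], [h + b], [h - b] lie in [C] together. *)
Lemma small_part_mem x : x \in S -> x + b \in C.
Proof.
rewrite mem_S => /and3P[xC x2 x4].
have [h [q [k [xE oh oq ox]]]] := odd_pow2_decomposition x.
have [k3 | k2] := leqP 3 k.
  apply: stC xC; apply: (cycle_addr_order4 odd_m cardG cyclic_Sylow2 ob).
  by rewrite ox dvdn_mull // (@dvdn_exp2l 2 3).
have h0 : h != 0.
  apply/eqP => h0; move: xE; rewrite h0 add0r => xq.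
  move: x2 x4 oq; rewrite -xq; case: k k2 {ox} => [|[|[|k]]] // _.
  - by move=> _ _ /eqP; rewrite order_eq1 => /eqP x0; move: C_irrefl xC; rewrite x0 => /negPf ->.
  - by move/eqP.
  - by move=> _ /eqP.
have invN : (h \in C) = (h - b \in C).
  have oNb : #[- b]%g = 4%N by rewrite -[- b]/(b^-1)%g orderV.
  rewrite inv_b //; apply/idP/idP.
    exact: (stable_oddD odd_m cardG cyclic_Sylow2 stC oh ob oNb).
  exact: (stable_oddD odd_m cardG cyclic_Sylow2 stC oh oNb ob).
rewrite xE in xC *; case: k k2 oq {ox} => [|[|[|k]]] // _ oq.
- have q0 : q = 0 by move/eqP: oq; rewrite order_eq1 => /eqP.
  by move: xC; rewrite q0 addr0 inv_b.
- have qa : q = a by apply: (order2_unique odd_m cardG cyclic_Sylow2).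
  by rewrite qa -addrA -oppb -invN inv_a // -qa.
have [qb | qb] := order4_unique odd_m cardG cyclic_Sylow2 ob oq.
  by rewrite qb -addrA doubleb -inv_a // inv_b // -qb.
by rewrite qb subrK invN -qb.
Qed.

(** Only [b], 0 and [a] are shifted by [b] to [a], [b] and [- b], and none of them is in [S]. *)
Lemma small_part_shift x : x \in S -> x + b \in S.
Proof.
move=> xS; have xbC := small_part_mem xS; move: xS; rewrite !mem_S xbC /=.
move=> /and3P[xC x2 x4]; apply/andP; split.
  apply: contraNneq x4 => /(order2_unique odd_m cardG cyclic_Sylow2)/(_ oa).
  by rewrite -doubleb => /addIr ->; rewrite ob.
apply/eqP => /(order4_unique odd_m cardG cyclic_Sylow2 ob)[xb | xb].
  have x0 : x = 0 by apply: (addIr b); rewrite add0r.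
  by move: C_irrefl; rewrite -x0 xC.
by move: xb; rewrite oppb => /addIr xa; rewrite xa oa in x2.
Qed.

Section Characters.
Variables (N : nat) (z : algC) (f : {ffun G -> 'Z_N}).
Hypotheses (N_gt1 : (1 < N)%N) (prim_z : N.-primitive_root z).
Hypothesis fD : f \in dual N G.
Local Notation ev := (character_value z).

Lemma fourier_small_part : exists k : int, fourier z S f = (4 * k)%:~R.
Proof.
have /intrP[x xE] := fourier_int N_gt1 prim_z small_part_stable fD.
have [y yA] := fourier_periodic N_gt1 prim_z fD small_part_shift.
rewrite xE ob => yE; have /dvdzP[k kE] := @Aint_dvdz 4 x y isT yA yE.
by exists k; rewrite kE mulrC.
Qed.

Lemma ev_order2 : ev f a = if f a == 0 then 1 else -1.
Proof.
have a2 : a *+ 2 = 0 by apply/eqP; rewrite -order_addE oa.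
have : ev f a ^+ 2 == 1 by rewrite -(evMn N_gt1 prim_z) // a2 (ev0 N_gt1 prim_z).
rewrite sqrf_eq1 (ev_eq1 N_gt1 prim_z); case: eqP => [fa0 _|_ /= /eqP //].
by rewrite /character_value fa0 expr0.
Qed.

Lemma fourier_residue_a : a \in C -> b \notin C -> exists k : int,
  fourier z C f = (4 * k + (if f a == 0 then - 1 + 2 else - 1))%:~R.
Proof.
move=> aC bC; have CE : C = a |: S.
  apply/setP => x; rewrite finset.in_setU1 mem_S.
  apply/idP/orP => [xC | [/eqP -> //|/and3P[]//]].
  have [x2|x2] := eqVneq #[x]%g 2%N.
    by left; apply/eqP/(order2_unique odd_m cardG cyclic_Sylow2).
  have [x4|x4] := eqVneq #[x]%g 4%N; last by right; rewrite xC.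
  by move: xC bC; have [-> ->|->] := order4_unique odd_m cardG cyclic_Sylow2 ob x4;
    rewrite ?mem_opp_b // => ->.
have [k kE] := fourier_small_part; exists k.
rewrite {1}CE /fourier big_setU1 /=; last by rewrite mem_S oa eqxx andbF.
rewrite -[\sum_(x in S) _]/(fourier z S f) kE ev_order2 intrD addrC.
by case: ifP.
Qed.

(** Since [f(b) ^ 2 = f(a)], the sum of [f(b)] and its inverse is 2 or -2 if [f(a) = 1], and 0 if
    [f(a) = -1]. *)
Lemma fourier_residue_b : a \notin C -> b \in C -> exists k : int,
  fourier z C f = (4 * k + (if f a == 0 then 0 + 2 else 0))%:~R.
Proof.
move=> aC bC; have CE : C = b |: (- b |: S).
  apply/setP => x; rewrite !finset.in_setU1 mem_S.
  apply/idP/or3P => [xC | [/eqP -> //|/eqP ->|/and3P[]//]]; last by rewrite mem_opp_b.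
  have [x4|x4] := eqVneq #[x]%g 4%N.
    have [->|->] := order4_unique odd_m cardG cyclic_Sylow2 ob x4.
      by constructor 1.
    by constructor 2.
  have [x2|x2] := eqVneq #[x]%g 2%N; last by constructor 3; rewrite xC.
  by rewrite (order2_unique odd_m cardG cyclic_Sylow2 oa x2) xC in aC.
have a0 : a != 0 by apply: contra_eq_neq oa => ->; rewrite order1.
have bNb : b != - b by rewrite -addr_eq0 doubleb.
have oNb : #[- b]%g = 4%N by rewrite -[- b]/(b^-1)%g orderV.
have [k kE] := fourier_small_part.
have F : fourier z C f = ev f b + (ev f b)^-1 + (4 * k)%:~R.
  rewrite {1}CE /fourier big_setU1 /=; last first.
    by rewrite finset.in_setU1 mem_S ob eqxx !andbF orbF.
  rewrite big_setU1 /=; last by rewrite mem_S oNb eqxx !andbF.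
  by rewrite -[\sum_(x in S) _]/(fourier z S f) kE (evN N_gt1 prim_z) // addrA.
have b2 : ev f b ^+ 2 = ev f a by rewrite -(evMn N_gt1 prim_z) // mulr2n doubleb.
rewrite F; move: b2; rewrite ev_order2; case: eqP => fa0 /eqP b2.
  move: b2; rewrite sqrf_eq1 => /orP[] /eqP ->.
    by exists k; rewrite invr1 add0r addrC [RHS]intrD.
  (* The two terms sum to -2, which is 2 - 4. *)
  by exists (k - 1); rewrite invrN1; ring.
exists k; rewrite addr0 (_ : (ev f b)^-1 = - ev f b) ?subrr ?add0r //.
apply: (mulfI (ev_neq0 N_gt1 prim_z f b)).
by rewrite divff ?(ev_neq0 N_gt1 prim_z) // mulrN -expr2 (eqP b2) opprK.
Qed.

End Characters.

Lemma pst_backward2 : (a \in C) != (b \in C) ->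
  perfect_state_transfer R (cayley_graph C).
Proof.
have [N [z [N_gt1 dvdGN prim_z]]] := exists_splitting_root G.
case: (boolP (a \in C)) => aC; case: (boolP (b \in C)) => bC // _.
  apply: (pst_of_residues R N_gt1 dvdGN prim_z C_sym oa (r := -1)) => f fD.
  exact: fourier_residue_a.
apply: (pst_of_residues R N_gt1 dvdGN prim_z C_sym oa (r := 0)) => f fD.
exact: fourier_residue_b.
Qed.

End Backward.

(** * The case d = 1: perfect matchings *)

Section Matching.
Variables (R : realType) (G : finZmodType) (m : nat) (C : {set G}) (a : G).
Hypotheses (odd_m : odd m) (cardG : #|G| = (2 ^ 1 * m)%N).
Hypothesis cyclic_Sylow2 :
  forall P : {group G}, (2.-Sylow([set: G]) P)%g -> cyclic P.
Hypothesis oa : #[a]%g = 2%N.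

Let H := [set x : G | x *+ m == 0].

Let aa : a + a = 0.
Proof. by apply/eqP; rewrite -mulr2n -order_addE oa. Qed.

Let am : a *+ m = a.
Proof.
rewrite -(odd_double_half m) odd_m -mul2n mulrnDr mulrnA mulr2n aa mul0rn.
by rewrite addr0.
Qed.

(** Multiplication by [m] projects onto the Sylow 2-subgroup, since [2 m] kills [G]. *)
Lemma odd_part_coordinate (x : G) : (x *+ m == 0) || (x *+ m == a).
Proof.
have x2 : x *+ m *+ 2 = 0.
  by apply/eqP; rewrite -mulrnA -order_addE mulnC (order_dvd_card cardG).
case: eqP => //= /eqP x0; apply/eqP/(order2_unique odd_m cardG cyclic_Sylow2) => //.
by apply: nt_prime_order; rewrite ?inE.
Qed.

(* G is the direct product of its elements of odd order and {0, a}. *)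
Lemma matching_coordinates : exists2 h : G -> 'I_m * bool, bijective h &
  forall x y, ((h x).1 == (h y).1) && ((h x).2 != (h y).2) = (y == x + a).
Proof.
have a0 : a != 0 by apply: contra_eq_neq oa => ->; rewrite order1.
pose f (x : G) : G * bool := (if x *+ m == 0 then x else x + a, x *+ m == 0).
have fH x : (f x).1 \in H.
  rewrite inE /=; have := odd_part_coordinate x; case: ifP => //= xm /eqP xa.
  by rewrite mulrnDl xa am aa.
have f_inj : injective f.
  move=> x y [] + E; rewrite E; case: ifP => // _.
  exact: addIr.
have f_surj (u : G * bool) : u.1 \in H -> exists x, f x = u.
  case: u => h c /=; rewrite inE => /eqP hm; exists (if c then h else h + a).
  rewrite /f; case: c; first by rewrite hm eqxx.
  by rewrite mulrnDl hm am add0r (negPf a0) -addrA aa addr0.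
have imf : f @: [set: G] = finset.setX H [set: bool].
  apply/setP => -[h c]; rewrite finset.in_setX finset.in_setT andbT.
  apply/imsetP/idP => [[x _ E] | hH]; first by have := fH x; rewrite -E.
  by have [x <-] := f_surj (h, c) hH; exists x; rewrite ?inE.
have cardH : #|H| = m.
  by have := card_imset [set: G] f_inj; rewrite imf cardsX !cardsT card_bool cardG; lia.
have H0 : 0 \in H by rewrite inE mul0rn.
pose h x := (cast_ord cardH (enum_rank_in H0 (f x).1), (f x).2).
have hE x y : ((h x).1 == (h y).1) = ((f x).1 == (f y).1).
  rewrite (inj_eq (@cast_ord_inj _ _ cardH)); apply/eqP/eqP => [|-> //].
  by apply: enum_rank_in_inj; apply: fH.
have h_inj : injective h.
  move=> x y xy; apply: f_inj; apply/eqP; rewrite -pair_eqE /pair_eq /= -hE xy eqxx.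
  by have /(congr1 snd) /= -> := xy; rewrite eqxx.
exists h.
  by apply: inj_card_bij h_inj _; rewrite card_prod card_ord card_bool cardG mulnC.
move=> x y; rewrite hE /=; have [->|yNxa] := eqVneq y (x + a).
  rewrite mulrnDl am; have [xm|xm] := eqVneq (x *+ m) 0.
    by rewrite xm add0r (negPf a0) -addrA aa addr0 eqxx.
  have /eqP -> : x *+ m == a by have := odd_part_coordinate x; rewrite (negPf xm).
  by rewrite aa !eqxx.
case: (x *+ m == 0); case: (y *+ m == 0); rewrite ?andbF // andbT.
  by apply: contraNF yNxa => /eqP ->; rewrite -addrA aa addr0.
by apply: contraNF yNxa => /eqP ->.
Qed.

Lemma matching_iso : C = [set a] -> graph_iso (cayley_graph C) (@copies_K2 m).
Proof.
move=> ->; have [h h_bij hE] := matching_coordinates.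
exists h => // x y; rewrite /copies_K2 hE /cayley_graph inE.
by rewrite subr_eq addrC.
Qed.

(** Each vertex of [m K_2] has exactly one neighbour, so [C] is a singleton; its element is nonzero
    and equal to its inverse, hence of order two. *)
Lemma iso_matching : (forall g, g \in C -> - g \in C) -> 0 \notin C ->
  graph_iso (cayley_graph C) (@copies_K2 m) -> C = [set a].
Proof.
move=> C_sym C_irrefl [h [h' hK h'K] hE].
pose c := h' ((h 0).1, ~~ (h 0).2).
have CE : C = [set c].
  apply/setP => x; rewrite inE.
  have -> : (x \in C) = cayley_graph C 0 x by rewrite /cayley_graph subr0.
  rewrite -hE /copies_K2 /c -(inj_eq (can_inj hK)) h'K.
  case: (h 0) (h x) => i s [j t] /=; rewrite xpair_eqE eq_sym.
  by congr (_ && _); case: s; case: t.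
have cC : c \in C by rewrite CE inE.
have c0 : c != 0 by apply: contraNneq C_irrefl => <-.
have c2 : c *+ 2 = 0.
  have := C_sym _ cC; rewrite {1}CE inE => /eqP cN.
  by rewrite mulr2n -{1}cN addNr.
rewrite CE; congr [set _]; apply: (order2_unique odd_m cardG cyclic_Sylow2) => //.
by apply: nt_prime_order; rewrite ?inE.
Qed.

(** The eigenvalues are the values [f(a)], that is 1 or -1, which are the residues for [r = -1]. *)
Lemma pst_matching : C = [set a] -> perfect_state_transfer R (cayley_graph C).
Proof.
move=> CE; have [N [z [N_gt1 dvdGN prim_z]]] := exists_splitting_root G.
have C_sym g : g \in C -> - g \in C.
  rewrite CE !inE => /eqP ->; apply/eqP/esym/eqP; rewrite -addr_eq0.
  by rewrite aa.
apply: (pst_of_residues R N_gt1 dvdGN prim_z C_sym oa (r := -1)) => f fD.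
exists 0; rewrite /fourier CE big_set1 (ev_order2 oa N_gt1 prim_z fD).
by case: ifP.
Qed.

End Matching.

(** * Assembly of the cases d = 0, d = 1 and d >= 2 *)

Theorem theorem9p1 (R : realType) (G : finZmodType) (d m : nat)
    (C : {set G}) :
  odd m -> #|G| = (2 ^ d * m)%N ->
  (forall P : {group G}, (2.-Sylow([set: G]) P)%g -> cyclic P) ->
  (forall g, g \in C -> - g \in C) -> 0 \notin C ->
  [/\ d = 0%N -> ~ perfect_state_transfer R (cayley_graph C),
      d = 1%N -> (perfect_state_transfer R (cayley_graph C) <->
                  graph_iso (cayley_graph C) (@copies_K2 m))
    & (2 <= d)%N ->
      [/\ exists! a : G, #[a]%g = 2%N,
          exists b : G, b != - b /\
            forall x : G, #[x]%g = 4%N <-> x = b \/ x = - b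
        & forall a b : G, #[a]%g = 2%N -> #[b]%g = 4%N ->
            (perfect_state_transfer R (cayley_graph C) <->
             [/\ power_closed C,
                 (a \in C \/ b \in C) /\ ~ (a \in C /\ b \in C),
                 order_part C 0 = mulset 4 (order_part C 2 :\: [set - b; b])
               & order_part C 1 :\ a
                   = mulset 2 (order_part C 2 :\: [set - b; b])])]].
Proof.
move=> odd_m cardG cyclic_Sylow2 C_sym C_irrefl; split.
- move=> d0 pst; have [N [z [N_gt1 dvdGN prim_z]]] := exists_splitting_root G.
  have [a [_ [_ [a0 aa _ _]]]] := pst_congruence N_gt1 dvdGN prim_z C_sym C_irrefl pst.
  have oa : #[a]%g = 2%N by apply: nt_prime_order => //; rewrite -[LHS]/(a *+ 2) mulr2n.
  by have := order_dvd_card cardG a; rewrite oa d0 mul1n dvdn2 odd_m.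
- move=> d1; rewrite d1 in cardG.
  have [a oa] := exists_order_pow2 odd_m cardG cyclic_Sylow2 (leqnn 1).
  split=> [pst | iso].
    apply: (matching_iso odd_m cardG cyclic_Sylow2 oa).
    exact: (pst_forward1 odd_m cardG cyclic_Sylow2 C_sym C_irrefl oa (erefl 1%N) pst).
  apply: (pst_matching R oa).
  exact: (iso_matching odd_m cardG cyclic_Sylow2 oa C_sym C_irrefl iso).
move=> d2; split.
- have [a oa] := exists_order_pow2 odd_m cardG cyclic_Sylow2 (ltnW d2).
  exists a; split=> // x ox.
  exact: (order2_unique odd_m cardG cyclic_Sylow2).
- have [b ob] := exists_order_pow2 odd_m cardG cyclic_Sylow2 d2.
  exists b; split=> [|x].
    by rewrite -addr_eq0 -mulr2n -order_addE ob.
  exact: (signed_order4P odd_m cardG cyclic_Sylow2 ob).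
move=> a b oa ob.
have abE : (a \in C) != (b \in C) <->
    (a \in C \/ b \in C) /\ ~ (a \in C /\ b \in C).
  by case: (a \in C); case: (b \in C); split=> //; intuition.
split=> [pst | [/power_closedP stC /abE ab E0 E1]].
  have [stC /abE ab inv_a inv_b] :=
    pst_forward2 odd_m cardG cyclic_Sylow2 C_sym C_irrefl oa ob pst.
  have [E0 E1] := (order_parts_translation odd_m cardG cyclic_Sylow2 C_irrefl
    oa ob stC).1 (conj inv_a inv_b).
  by split=> //; apply/power_closedP.
have [inv_a inv_b] := (order_parts_translation odd_m cardG cyclic_Sylow2 C_irrefl
  oa ob stC).2 (conj E0 E1).
exact: (pst_backward2 R odd_m cardG cyclic_Sylow2 C_sym C_irrefl oa ob stC inv_a inv_b).
Qed.
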